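(* Let $\alpha > 0$ be fixed, and let $C > 6$ be a constant. Then there is $n_0$ (depending only on $\alpha$ and $C$) such that for every $n \geq n_0$ and every connected graph $G$ with $n$ vertices whose minimum degree is at least $\alpha n$, $$\max \{|x| \,:\, x \in \mathbb{C},\ S(G;x) = 0 \} \leq \frac{C}{\alpha \log n}.$$
   Context: Graphs are finite and simple; $\log$ is the natural logarithm. A subtree of a graph $G$ is any (not necessarily induced) subgraph of $G$ that is a tree (with at least one vertex). For a graph $G$ with $n$ vertices and a positive integer $k \leq n$, $s_k(G)$ denotes the number of subtrees of $G$ with exactly $k$ vertices. The subtree polynomial of $G$ is $S(G;x) = \sum_{k=1}^n s_k(G) x^k$. *)

(* Defs.v *)
From mathcomp Require Import all_boot all_order all_algebra.
From mathcomp Require Import boolp.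

Set Implicit Arguments.
Unset Strict Implicit.
Unset Printing Implicit Defensive.

Import GRing.Theory.
Local Open Scope ring_scope.

Record sgraph := SGraph {
  vertex :> finType;
  edge : rel vertex;
  edge_sym : symmetric edge;
  edge_irrefl : irreflexive edge }.

(* Paths are not required to stay in V: this is meant for relations e all of
   whose pairs lie in V. *)
Definition connected_on (T : finType) (V : {set T}) (e : rel T) : Prop :=
  V != set0 /\ {in V &, forall x y, connect e x y}.

(* A closed walk of size 2 in a symmetric relation is a single edge traversed
   back and forth, so that only simple cycles of size at least 3 count. *)
Definition acyclic (T : finType) (e : rel T) : Prop :=
  forall p : seq T, ucycle e p -> (size p <= 2)%N.

Definition connected (G : sgraph) : Prop := connected_on [set: G] (@edge G).

Definition degree (G : sgraph) (x : G) : nat := #|[set y | edge x y]|.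

Definition edges (G : sgraph) : {set {set G}} :=
  [set [set x; y] | x in [set: G], y in [set: G] & edge x y].

(* A subgraph, not necessarily induced, is a pair of a vertex set and a set of
   edges, each edge being an unordered pair. *)
Definition is_subgraph (G : sgraph) (H : {set G} * {set {set G}}) : Prop :=
  H.2 \subset edges G /\ {in H.2, forall f : {set G}, f \subset H.1}.

Definition adj (T : finType) (E : {set {set T}}) : rel T :=
  fun x y => [set x; y] \in E.

Definition is_subtree (G : sgraph) (H : {set G} * {set {set G}}) : Prop :=
  [/\ is_subgraph H, connected_on H.1 (adj H.2) & acyclic (adj H.2)].

Definition num_subtrees (G : sgraph) (k : nat) : nat :=
  #|[set H : {set G} * {set {set G}} | `[< is_subtree H >] & #|H.1| == k]|.

Definition subtree_poly (A : nzRingType) (G : sgraph) : {poly A} :=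
  \sum_(1 <= k < #|G|.+1) (num_subtrees G k)%:R *: 'X^k.

(* Main.v *)
(* Write z = 1/x and let tau(U) be the number of subtrees with vertex set U, so
   that a nonzero root x gives sum_A tau(V - A) z^|A| = 0. A spanning tree rooted at
   r is a map sending each vertex to its parent. Deleting a set A of leaves leaves a
   tree on V - A, to which A can be attached again in about prod_(a in A) d(a) ways.
   Hence the sum is close to the sum over spanning trees f of
   prod_(a leaf of f) (1 + z / d(a)), which is about sum_f exp (z l(f)) with
   l(f) = sum_(a leaf of f) 1 / d(a).
   Under independent uniform choices of the parents, l has bounded differences
   O(1/n), so it deviates from its mean mu by 1 / (10 log n) with probability at
   most 2 exp (- c n / (log n)^2). Spanning trees have probability at least
   exp (- O (sqrt n log n)) among all choices: grow forests from a connected core of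
   O(sqrt n) vertices that contains many neighbours of every vertex. So l is
   concentrated on spanning trees too, and the sum is about tau(V) exp (z mu), which
   is not 0. *)

From mathcomp Require Import boolp reals topology normedtype.
From mathcomp Require Import derive sequences exp trigo complex.
From mathcomp Require Import all_boot all_order all_algebra.
From mathcomp Require Import zify ring lra.
Require Import Defs.
Import Order.TTheory GRing.Theory Num.Theory.
Import numFieldNormedType.Exports.

Set Implicit Arguments.
Unset Strict Implicit.
Unset Printing Implicit Defensive.
Local Open Scope nat_scope.

(** * Subtrees as parent maps *)

(** Why 6: let D be the minimum degree and Y = |z| n / D. The main term is only known to exceed a
    constant times tau(V) exp (- Y), while the discarded terms have to be summed in absolute value.
    For small A they amount to about tau(V) exp (4 Y) / n, up to powers of log n. One factor 2 in
    that exponent comes from tau(V - A) <= tau(V) (D / 2)^(- |A|), the other from absorbing |A|^2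
    into 2 * 2^|A|. So 5 Y has to stay below log n; |x| > 6 / (alpha log n) gives Y <= log n / 6 and
    leaves n^(-1/6) for the powers of log n. For |A| > m, about D / 2, the bound on tau(V - A) stops
    improving, but the saving (D / 2)^(- m) already beats the whole binomial sum. Spanning trees
    have no product structure, hence the detour through independent parents. Its price, the inverse
    density of the trees, is affordable because sqrt n log n is far below n / (log n)^2. *)

Definition upd (T : eqType) (S : finType) (f : {ffun S -> T}) (v : S) (y : T) : {ffun S -> T} :=
  [ffun x => if x == v then y else f x].

Lemma upd_same (T : eqType) (S : finType) (f : {ffun S -> T}) (v : S) (y : T) :
  upd f v y v = y.
Proof. by rewrite ffunE eqxx. Qed.

Lemma upd_other (T : eqType) (S : finType) (f : {ffun S -> T}) (v x : S) (y : T) :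
  x != v -> upd f v y x = f x.
Proof. by move=> xv; rewrite ffunE (negbTE xv). Qed.

Lemma upd_upd (T : eqType) (S : finType) (f : {ffun S -> T}) (v : S) (y z : T) :
  upd (upd f v y) v z = upd f v z.
Proof. by apply/ffunP => x; rewrite !ffunE; case: eqP. Qed.

Lemma upd_id (T : eqType) (S : finType) (f : {ffun S -> T}) (v : S) :
  upd f v (f v) = f.
Proof. by apply/ffunP => x; rewrite ffunE; case: eqP => // ->. Qed.

Lemma upd_comm (T : eqType) (S : finType) (f : {ffun S -> T}) (v w : S) (y z : T) :
  v != w -> upd (upd f v y) w z = upd (upd f w z) v y.
Proof.
move=> vw; apply/ffunP => x; rewrite !ffunE.
by case: eqP => // ->; rewrite eq_sym (negbTE vw).
Qed.

Lemma fconnect_iterP (T : finType) (f : T -> T) (x y : T) :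
  reflect (exists k, iter k f x = y) (fconnect f x y).
Proof.
apply: (iffP idP) => [/iter_findex <-|[k <-]]; first by eexists.
exact: fconnect_iter.
Qed.

Lemma iter_fixed (T : Type) (f : T -> T) (x : T) k : f x = x -> iter k f x = x.
Proof. by move=> fx; elim: k => //= k ->. Qed.

(** A return to v would make its orbit periodic, so v would be met again after the orbit has stopped
    at the fixed point k. *)
Lemma fconnect_not_periodic (T : finType) (f : T -> T) (v k : T) :
  fconnect f v k -> f k = k -> v != k -> ~~ fconnect f (f v) v.
Proof.
move=> /fconnect_iterP[q qk] fk vk; apply/negP => /fconnect_iterP[p pv].
have per j : iter (j * p.+1) f v = v.
  by elim: j => // j IH; rewrite mulSn iterD IH iterSr.
suff : v = k by move/eqP; rewrite (negbTE vk).
rewrite -(per q) -(subnK (leq_pmulr q (ltn0Sn p))) iterD qk.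
exact: iter_fixed.
Qed.

Lemma iter_upd (T : finType) (f : {ffun T -> T}) (v y z : T) k :
  ~~ fconnect f y v -> iter k (upd f v z) y = iter k f y.
Proof.
move=> nyv; elim: k => //= k ->; rewrite upd_other //.
by apply: contraNneq nyv => <-; apply: fconnect_iter.
Qed.

Lemma fconnect_upd (T : finType) (f : {ffun T -> T}) (v y z w : T) :
  ~~ fconnect f y v -> fconnect (upd f v z) y w = fconnect f y w.
Proof.
move=> nyv; apply/fconnect_iterP/fconnect_iterP => -[k kE]; exists k.
  by rewrite -kE iter_upd.
by rewrite iter_upd.
Qed.

Definition nb (G : sgraph) (U : {set G}) (v : G) : {set G} := [set y in U | edge v y].

Lemma nbT (G : sgraph) (v : G) : #|nb [set: G] v| = degree v.
Proof. by rewrite /degree; apply: eq_card => y; rewrite !inE. Qed.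

Lemma nb_sub (G : sgraph) (U W : {set G}) (v : G) :
  U \subset W -> nb U v \subset nb W v.
Proof.
move/subsetP=> UW; apply/subsetP => y; rewrite !inE => /andP[yU ->].
by rewrite UW.
Qed.

(* Parent maps of the trees with vertex set U rooted at r. The root is its own
   parent, and so is every vertex outside U. *)
Definition treemaps (G : sgraph) (r : G) (U : {set G}) : {set {ffun G -> G}} :=
  [set f : {ffun G -> G} | [forall v, if v \in U :\ r then f v \in nb U v else f v == v]
           && [forall v in U, fconnect f v r]].

Lemma treemapsP (G : sgraph) (r : G) (U : {set G}) (f : {ffun G -> G}) :
  reflect [/\ {in U :\ r, forall v, f v \in nb U v},
              forall v, v \notin U :\ r -> f v = v
            & {in U, forall v, fconnect f v r}] (f \in treemaps r U).
Proof.
rewrite inE; apply: (iffP andP) => [[/forallP h1 /forall_inP h2]|[h1 h2 h3]].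
  split => // v; first by have := h1 v; case: ifP.
  by have := h1 v; case: ifP => // _ /eqP.
split; last exact/forall_inP.
by apply/forallP => v; case: ifPn => [/h1//|/h2 ->].
Qed.

Definition tau (G : sgraph) (U : {set G}) : nat :=
  #|[set H : {set G} * {set {set G}} | `[< is_subtree H >] & H.1 == U]|.

Lemma tau0 (G : sgraph) : tau (set0 : {set G}) = 0.
Proof.
apply/eqP; rewrite cards_eq0; apply/eqP/setP => H; rewrite !inE.
by apply/negP => /andP[/asboolP[_ [/negbTE H0 _] _]]; rewrite H0.
Qed.

Lemma num_subtreesE (G : sgraph) k :
  num_subtrees G k = \sum_(U : {set G} | #|U| == k) tau U.
Proof.
rewrite /num_subtrees -sum1_card.
rewrite (partition_big (fun H : {set G} * {set {set G}} => H.1) (fun U => #|U| == k)); last first.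
  by move=> H; rewrite inE => /andP[].
apply: eq_bigr => U /eqP Uk; rewrite /tau -sum1_card; apply: eq_bigl => H.
rewrite !inE -andbA; congr (_ && _).
by apply/andP/idP => [[]//|/eqP ->]; rewrite Uk !eqxx.
Qed.

Definition parent_edges (G : sgraph) (r : G) (U : {set G}) (f : {ffun G -> G}) : {set {set G}} :=
  [set [set v; f v] | v in U :\ r].

Lemma set2_eqP (T : finType) (a b c d : T) :
  [set a; b] = [set c; d] -> (a = c /\ b = d) \/ (a = d /\ b = c).
Proof.
move=> E.
have: a \in [set c; d] by rewrite -E set21.
have: b \in [set c; d] by rewrite -E set22.
have: c \in [set a; b] by rewrite E set21.
have: d \in [set a; b] by rewrite E set22.
by rewrite !inE => /orP[]/eqP ? /orP[]/eqP ? /orP[]/eqP ? /orP[]/eqP ?;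
  first [left; split; congruence | right; split; congruence].
Qed.

Lemma adj_parentP (G : sgraph) (r : G) (U : {set G}) (f : {ffun G -> G}) (x y : G) :
  reflect ((x \in U :\ r /\ y = f x) \/ (y \in U :\ r /\ x = f y))
          (adj (parent_edges r U f) x y).
Proof.
apply: (iffP imsetP) => [[v vU /set2_eqP[[-> ->]|[-> ->]]]|]; first by left.
  by right.
move=> [[xU ->]|[yU ->]]; [by exists x|by exists y => //; rewrite setUC].
Qed.

Lemma adj_sym (T : finType) (E : {set {set T}}) : symmetric (adj E).
Proof. by move=> x y; rewrite /adj setUC. Qed.

Lemma treemaps_inU (G : sgraph) (r : G) (U : {set G}) (f : {ffun G -> G}) (v : G) :
  r \in U -> f \in treemaps r U -> v \in U -> f v \in U.
Proof.
move=> rU /treemapsP[h1 h2 _] vU; case: (boolP (v \in U :\ r)) => [/h1|/h2-> //].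
by rewrite inE => /andP[].
Qed.

(** Induction along the g-path from v to r. If f v and g v differ, the edge from v to g v must be
    the f-edge of g v, so f (g v) = v; by induction g (g v) = v as well, and g would never reach r
    from v. *)
Lemma parent_edges_inj (G : sgraph) (r : G) (U : {set G}) :
  {in treemaps r U &, injective (parent_edges r U)}.
Proof.
move=> f g fT gT E; have /treemapsP[f1 f2 f3] := fT; have /treemapsP[g1 g2 g3] := gT.
have edgeE v : v \in U :\ r -> f v = g v \/ (f (g v) = v /\ g v \in U :\ r).
  move=> vU; have : adj (parent_edges r U g) v (g v) by apply/adj_parentP; left.
  rewrite -E => /adj_parentP[[_ ->]|[gvU fgv]]; [by left|by right].
suff H k v : v \in U :\ r -> iter k g v = r -> f v = g v.
  apply/ffunP => v; case: (boolP (v \in U :\ r)) => vU; last by rewrite f2 ?g2.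
  have /fconnect_iterP[k kE] : fconnect g v r.
    by apply: g3; move: vU; rewrite inE => /andP[].
  exact: (H k).
elim: k v => [v vU /= vr|k IH v vU]; first by move: vU; rewrite vr !inE eqxx.
rewrite iterSr => kE; case: (edgeE v vU) => [//|[fgv gvU]].
have ggv : g (g v) = v by rewrite -(IH _ gvU kE).
have vr : v != r by move: vU; rewrite !inE => /andP[].
have := @fconnect_not_periodic _ g v r.
rewrite g3; last by move: vU; rewrite inE => /andP[].
have -> : g r = r by apply: g2; rewrite !inE eqxx.
move=> /(_ isT erefl vr); have -> // : fconnect g (g v) v.
by apply/fconnect_iterP; exists 1.
Qed.

Lemma treemaps_subtree (G : sgraph) (r : G) (U : {set G}) (f : {ffun G -> G}) :
  r \in U -> f \in treemaps r U -> is_subtree (U, parent_edges r U f).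
Proof.
move=> rU fT; have /treemapsP[f1 f2 f3] := fT.
have fr : f r = r by apply: f2; rewrite !inE eqxx.
split=> /=.
- split=> /=.
    apply/subsetP => e /imsetP[v vU ->]; apply/imset2P.
    have := f1 v vU; rewrite inE => /andP[_ evf].
    by exists v (f v); rewrite ?inE.
  move=> e /imsetP[v vU ->]; apply/subsetP => x; rewrite !inE.
  have vU' : v \in U by move: vU; rewrite inE => /andP[].
  by case/orP => /eqP-> //; apply: treemaps_inU rU fT _.
- have toroot k v : v \in U -> iter k f v = r -> connect (adj (parent_edges r U f)) v r.
    elim: k v => [v _ /= -> //|k IH v vU]; rewrite iterSr => kE.
    have fvr : connect (adj (parent_edges r U f)) (f v) r.
      by apply: IH kE; apply: treemaps_inU rU fT vU.
    case: (eqVneq v r) => [-> //|vr].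
    apply: connect_trans fvr; apply: connect1; apply/adj_parentP; left.
    by rewrite !inE vr.
  have conr v : v \in U -> connect (adj (parent_edges r U f)) v r.
    by move=> vU; have /fconnect_iterP[k] := f3 v vU; apply: toroot.
  split; first by apply/set0Pn; exists r.
  move=> x y xU yU; apply: connect_trans (conr x xU) _.
  rewrite (sym_connect_sym (@adj_sym _ _)); exact: conr.
- (* A vertex of maximal depth on a cycle has only its parent as a neighbour there. *)
move=> p /andP[cp up]; rewrite leqNgt; apply/negP => p3.
pose dep v := findex f v r.
have [x0 x0p] : exists x, x \in p by case: (p) p3 => // a s _; exists a; rewrite mem_head.
have [x xp xmax] : exists2 x, x \in p & {in p, forall y, dep y <= dep x}.
  by case: (arg_maxnP dep x0p) => x xp xm; exists x.
have pU : {in p, forall y, y \in U}.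
  move=> y yp; have := next_cycle cp yp; move=> /adj_parentP[[]|[h ->]].
    by rewrite inE => /andP[].
  by apply: treemaps_inU rU fT _; move: h; rewrite inE => /andP[].
have dep_lt y : y \in U :\ r -> dep (f y) < dep y.
  rewrite !inE => /andP[yr yU]; rewrite /dep.
  have fy := f3 _ yU; have := iter_findex fy.
  case E: (findex f y r) => [|k]; first by move=> /= yE; rewrite yE eqxx in yr.
  rewrite iterSr => kE; rewrite ltnS -kE.
  have ford : findex f (f y) (iter k f (f y)) <= k.
    rewrite leqNgt; apply/negP => lt.
    have klt : k < order f (f y).
      by apply: ltn_trans lt _; apply: findex_max; apply: fconnect_iter.
    by move: lt; rewrite findex_iter // ltnn.
  exact: ford.
have only y : y \in p -> adj (parent_edges r U f) x y -> y = f x.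
  move=> yp /adj_parentP[[_ //]|[yU xE]].
  by have := xmax _ yp; rewrite xE leqNgt dep_lt.
have nx : next p x = f x by apply: only; rewrite ?mem_next ?next_cycle.
have px : prev p x = f x.
  by apply: only; rewrite ?mem_prev // adj_sym prev_cycle.
(* Both cycle neighbours of x are its parent, so the cycle closes after two steps although it has at
   least three vertices. *)
have : next p (next p x) = x by rewrite nx -px next_prev.
case: (rot_to xp) => i s ps.
have up' : uniq (x :: s) by rewrite -ps rot_uniq.
rewrite -!(next_rot i up) ps.
have : 2 < size (x :: s) by rewrite -ps size_rot.
case: s {ps} up' => [|a [|b s]] //= /andP[]; rewrite !inE !negb_or => /and3P[xa xb xs].
move=> _ _; rewrite eqxx (eq_sym a x) (negbTE xa) eqxx => bx.
by rewrite bx eqxx in xb.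
Qed.

Lemma subtree_edge (G : sgraph) (H : {set G} * {set {set G}}) (x y : G) :
  is_subgraph H -> adj H.2 x y -> [/\ edge x y, x \in H.1 & y \in H.1].
Proof.
move=> [/subsetP HE HV] xy.
have /subsetP xyU := HV _ xy.
have xU : x \in H.1 by apply: xyU; rewrite !inE eqxx.
have yU : y \in H.1 by apply: xyU; rewrite !inE eqxx orbT.
split=> //; have /imset2P[a b _] := HE _ xy.
rewrite inE => /andP[_ eab] /set2_eqP[[-> ->]//|[-> ->]].
by rewrite edge_sym.
Qed.

(* Parents point along shortest paths to r. *)
Lemma subtree_parents (G : sgraph) (r : G) (H : {set G} * {set {set G}}) :
  is_subtree H -> r \in H.1 ->
  exists2 f, f \in treemaps r H.1 & H.2 = parent_edges r H.1 f.
Proof.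
move=> [Hsub [_ Hcon] Hac] rU.
pose e := adj H.2.
(* The distance to r in the tree. The implication is inside the existential so that [choice] gives a
   total function, with the dummy value 0 outside the tree. *)
have dEx v : exists k, v \in H.1 ->
    (exists2 p, path e v p /\ last v p = r & size p = k)
    /\ forall p, path e v p -> last v p = r -> k <= size p.
  case: (boolP (v \in H.1)) => [vU|_]; last by exists 0.
  have /connectP[p0 p0P p0l] := Hcon v r vU rU.
  have ex : exists k, `[< exists2 p, path e v p /\ last v p = r & size p = k >].
    by exists (size p0); apply/asboolP; exists p0.
  case: (ex_minnP ex) => k /asboolP kP kmin.
  exists k => _; split => // p pP pl; apply: kmin; apply/asboolP; by exists p.
have [d dP] := choice dEx.
have step v : v \in H.1 :\ r -> exists y, e v y /\ d y < d v.
  rewrite !inE => /andP[vr vU]; have [[[|y p] [/= pP pl] <-] _] := dP v vU.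
    by rewrite pl eqxx in vr.
  move: pP => /andP[vy pP]; exists y; split => //.
  have [_ _ yU] := subtree_edge Hsub vy.
  by have [_] := dP y yU; apply.
have gEx v : exists y, if v \in H.1 :\ r then e v y /\ d y < d v else y = v.
  by case: (boolP (v \in H.1 :\ r)) => [/step//|_]; exists v.
have [g gP] := choice gEx.
pose f : {ffun G -> G} := [ffun v => g v].
have fP v : v \in H.1 :\ r -> e v (f v) /\ d (f v) < d v.
  by move=> vU; have := gP v; rewrite vU ffunE.
have fid v : v \notin H.1 :\ r -> f v = v.
  by move=> vU; have := gP v; rewrite (negbTE vU) ffunE.
have fT : f \in treemaps r H.1.
  apply/treemapsP; split=> //.
    move=> v vU; have [vf _] := fP v vU.
    by rewrite inE; have [-> _ ->] := subtree_edge Hsub vf.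
  suff main k v : v \in H.1 -> d v <= k -> fconnect f v r.
    by move=> v vU; apply: (main (d v)).
  elim: k v => [|k IH] v vU dk; case: (eqVneq v r) => [-> //|vr].
  - have [_] : e v (f v) /\ d (f v) < d v by apply: fP; rewrite !inE vr.
    by rewrite ltnNge (leq_trans dk).
  - have [evf df] : e v (f v) /\ d (f v) < d v by apply: fP; rewrite !inE vr.
    have [_ _ fU] := subtree_edge Hsub evf.
    apply: connect_trans (fconnect1 f v) (IH _ fU _).
    by rewrite -ltnS (leq_trans df).
exists f => //; apply/eqP; rewrite eqEsubset; apply/andP; split; last first.
  apply/subsetP => E /imsetP[v vU ->]; by have [] := fP v vU.
(* An edge of H that is not a parent edge closes a cycle with a path of parent edges. *)
apply/subsetP => E EH; apply/negPn/negP => nE.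
have [/subsetP HE _] := Hsub; have /imset2P[x y _] := HE E EH.
rewrite inE => /andP[_ exy] EE; subst E.
have [_ xU yU] := subtree_edge Hsub EH.
have [_ [_ Tcon] _] := treemaps_subtree rU fT.
have /connectP[p pP pl] := Tcon x y xU yU.
move: pP pl => /shortenP[q qP qu _ ql].
have qe : path e x q.
  by apply: sub_path qP => a b /imsetP[v vU E]; have [h _] := fP v vU; rewrite /e /adj E.
have xy : x != y by apply: contraTneq exy => ->; rewrite edge_irrefl.
have : ucycle e (x :: q).
  by rewrite /ucycle qu andbT /= rcons_path qe -ql /e adj_sym.
move/Hac; case: q qP ql {qe qu} => [|a [|b q]] //=; first by move=> _ E; rewrite -E eqxx in xy.
by rewrite andbT => h E; move: h; rewrite -E /adj (negbTE nE).
Qed.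

Lemma tauE (G : sgraph) (r : G) (U : {set G}) :
  r \in U -> tau U = #|treemaps r U|.
Proof.
move=> rU; rewrite -(@card_in_imset _ _ (fun f => (U, parent_edges r U f)) (treemaps r U)).
  apply: eq_card => H; rewrite inE; apply/andP/imsetP => [[/asboolP Ht /eqP HU]|[f fT ->]].
    have rH : r \in H.1 by rewrite HU.
    have [f fT HE] := subtree_parents Ht rH.
    by exists f; rewrite -HU // -HE; case: (H).
  by split=> //=; apply/asboolP; apply: treemaps_subtree.
by move=> f g fT gT [E]; apply: (@parent_edges_inj G r U).
Qed.

(* All vertices of W outside U are leaves, attached to a tree on U. *)
Lemma card_treemaps_into (G : sgraph) (r : G) (U W : {set G}) :
  r \in U -> U \subset W ->
  #|[set f in treemaps r W | [forall v in W, f v \in U]]| =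
  tau U * \prod_(a in W :\: U) #|nb U a|.
Proof.
move=> rU UW; rewrite (tauE rU).
(* Vertices that are not attached as leaves get a single choice, so that the attachments form a
   product [family]. *)
pose F a : {set G} := if a \in W :\: U then nb U a else [set a].
have -> : \prod_(a in W :\: U) #|nb U a| = #|[set h : {ffun G -> G} in family F]|.
  rewrite cardsE card_family foldrE big_map big_enum /= big_mkcond /=.
  by apply: eq_bigr => a _; rewrite /F; case: ifP => // _; rewrite cards1.
rewrite -cardsX.
pose glue (gh : {ffun G -> G} * {ffun G -> G}) : {ffun G -> G} :=
  [ffun v => if v \in U then gh.1 v else gh.2 v].
rewrite -(@card_in_imset _ _ glue); last first.
  move=> [g h] [g' h'] /setXP[/= gT]; rewrite inE => /familyP hF /setXP[/= gT'].
  rewrite inE => /familyP hF' /ffunP E.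
  have /treemapsP[_ g2 _] := gT; have /treemapsP[_ g2' _] := gT'.
  congr (_, _); apply/ffunP => v; have := E v; rewrite !ffunE /=; case: ifPn => // vU _.
    by rewrite g2 ?g2' // inE (negbTE vU) andbF.
  have := hF v; have := hF' v; rewrite /F inE vU /=.
  by rewrite !inE => /eqP-> /eqP->.
have iterU (g h : {ffun G -> G}) v k : (forall v, v \in U -> g v = h v) ->
    (forall v, v \in U -> g v \in U) -> v \in U -> iter k g v = iter k h v.
  move=> gh gU vU; suff : iter k g v = iter k h v /\ iter k g v \in U by case.
  elim: k => //= k [IH1 IH2]; split; last exact: gU.
  by rewrite -IH1 gh.
apply: eq_card => f; rewrite inE; apply/andP/imsetP => [[fT /forall_inP fU]|].
  have /treemapsP[f1 f2 f3] := fT.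
  pose g : {ffun G -> G} := [ffun v => if v \in U then f v else v].
  pose h : {ffun G -> G} := [ffun v => if v \in U then v else f v].
  exists (g, h); last by apply/ffunP => v; rewrite !ffunE /=; case: (v \in U).
  apply/setXP; split=> /=.
    apply/treemapsP; split.
    - move=> v; rewrite inE => /andP[vr vU]; rewrite ffunE vU.
      have vW := subsetP UW _ vU.
      have : v \in W :\ r by rewrite inE vr.
      by move/f1; rewrite !inE fU // => /andP[_ ->].
    - move=> v; rewrite inE negb_and negbK ffunE; case: ifP => // vU.
      by rewrite orbF => vr; apply: f2; rewrite inE vr.
    - move=> v vU; have /fconnect_iterP[k kE] := f3 _ (subsetP UW _ vU).
      apply/fconnect_iterP; exists k; rewrite -kE; apply: iterU => // w wU.
        by rewrite ffunE wU.
      by rewrite ffunE wU fU // (subsetP UW).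
  rewrite inE; apply/familyP => v; rewrite /F ffunE; case: (boolP (v \in W :\: U)) => vWU.
    have /andP[vU vW] : (v \notin U) && (v \in W) by rewrite -in_setD.
    rewrite (negbTE vU).
    have : v \in W :\ r by rewrite !inE vW andbT; apply: contraNneq vU => ->.
    by move/f1; rewrite !inE fU // => /andP[_ ->].
  rewrite inE; case: ifPn => // vU; rewrite f2 //.
  by apply: contra vWU; rewrite !inE vU => /andP[].
move=> [[g h] /setXP[/= gT]]; rewrite inE => /familyP hF ->.
have /treemapsP[g1 g2 g3] := gT.
have gU v : v \in U -> g v \in U by move/(treemaps_inU rU gT).
have hE1 v : v \notin U -> v \in W -> h v \in nb U v.
  by move=> vU vW; have := hF v; rewrite /F inE vU vW.
have hE2 v : v \notin U -> v \notin W -> h v = v.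
  by move=> vU vW; have := hF v; rewrite /F inE vU (negbTE vW) => /set1P.
have glueU v : v \in W -> glue (g, h) v \in U.
  move=> vW; rewrite ffunE; case: ifPn => [/gU//|/hE1/(_ vW)].
  by rewrite inE => /andP[].
have glU v : v \in U -> fconnect (glue (g, h)) v r.
  move=> vU; have /fconnect_iterP[k kE] := g3 _ vU; apply/fconnect_iterP; exists k.
  rewrite -kE; apply: iterU => // w wU; first by rewrite ffunE wU.
  by rewrite glueU // (subsetP UW).
split; last exact/forall_inP.
apply/treemapsP; split.
- move=> v; rewrite inE => /andP[vr vW]; rewrite ffunE; case: ifPn => vU /=.
    have : v \in U :\ r by rewrite inE vr.
    by move/g1; apply: (subsetP (nb_sub _ UW)).
  by apply: (subsetP (nb_sub _ UW)); apply: hE1.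
- move=> v; rewrite inE negb_and negbK => /orP[/set1P->|vW]; rewrite ffunE /=.
    by rewrite rU g2 // !inE eqxx.
  by have vU := contraNN (subsetP UW v) vW; rewrite (negbTE vU) hE2.
- move=> v vW; apply: connect_trans (fconnect1 _ v) _; exact/glU/glueU.
Qed.

(** Only the trees in which v is a leaf are counted on the left. *)
Lemma tau_add (G : sgraph) (U : {set G}) (v : G) :
  v \notin U -> tau U * #|nb U v| <= tau (v |: U).
Proof.
move=> vU; case: (set_0Vmem U) => [->|[r rU]]; first by rewrite tau0.
have rU' : r \in v |: U by rewrite inE rU orbT.
rewrite (tauE rU'); have := card_treemaps_into rU (subsetUr [set v] U).
have -> : (v |: U) :\: U = [set v].
  by apply/setP => x; rewrite !inE; case: eqP => [->|_]; rewrite ?vU //= andNb.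
rewrite big_set1 => <-; apply: subset_leq_card; apply/subsetP => f.
by rewrite inE => /andP[].
Qed.

Lemma connected_nb (G : sgraph) (U : {set G}) : connected G -> U != set0 -> U != setT ->
  exists2 v, v \notin U & 0 < #|nb U v|.
Proof.
move=> [_ con] /set0Pn[u uU] UT.
have [w wU] : exists w, w \notin U.
  by apply/existsP; rewrite -negb_forall; apply: contra UT => /forallP h; apply/eqP/setP => x; rewrite h inE.
have /connectP[p pP pl] := con u w (in_setT _) (in_setT _).
elim: p u uU pP pl => [u uU _ pl|a p IH u uU /= /andP[ua pP] pl]; first by rewrite pl /= uU in wU.
case: (boolP (a \in U)) => aU; first exact: IH pP pl.
by exists a => //; apply/card_gt0P; exists u; rewrite inE uU edge_sym.
Qed.

(** Strict because v itself lies outside U and is not its own neighbour. *)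
Lemma nb_lb (G : sgraph) (U : {set G}) (v : G) : v \notin U ->
  degree v < #|nb U v| + #|~: U|.
Proof.
move=> vU; rewrite (cardsD1 v (~: U)) inE vU add1n addnS ltnS.
rewrite /degree; apply: leq_trans (leq_card_setU _ _); apply: subset_leq_card.
apply/subsetP => y; rewrite !inE => vy; rewrite vy andbT.
by case: (boolP (y \in U)) => //= _; rewrite andbT; apply: contraTneq vy => ->; rewrite edge_irrefl.
Qed.

(* Add the missing vertices one at a time: connectivity gives each of them at least
   one place, and each of the last m at least D - m places. *)
Lemma tau_lb (G : sgraph) (D m : nat) (U : {set G}) : connected G ->
  (forall v : G, D <= degree v) -> U != set0 ->
  tau U * (D - m) ^ minn #|~: U| m <= tau [set: G].
Proof.
move=> con deg; move: {2}#|~: U| (erefl #|~: U|) => j; elim: j U => [|j IH] U jE U0.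
  have -> : U = setT by apply: setC_inj; rewrite setCT; apply/eqP; rewrite -cards_eq0 jE.
  by rewrite setCT cards0 min0n muln1.
have UT : U != setT by apply: contra_eqN jE => /eqP->; rewrite setCT cards0.
have [v vU nv0] := connected_nb con U0 UT.
have jE' : #|~: (v |: U)| = j.
  move: jE; rewrite (cardsD1 v) inE vU add1n => -[<-]; apply: eq_card => x; rewrite !inE.
  by case: eqP.
have vU0 : v |: U != set0 by apply/set0Pn; exists v; rewrite !inE eqxx.
have := IH _ jE' vU0; rewrite jE jE'; apply: leq_trans.
apply: leq_trans (leq_mul (tau_add vU) (leqnn _)).
rewrite -mulnA leq_mul2l; apply/orP; right.
(* While more than m vertices are missing, the exponent stays m and the one place given by
   connectivity suffices. *)
case: (leqP m j) => jm; first by rewrite (minn_idPr _) 1?(minn_idPr _) ?(leqW jm) // leq_pmull.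
rewrite (minn_idPl _) // expnS leq_mul2r; apply/orP; right.
have := nb_lb vU; have := deg v; rewrite jE; lia.
Qed.

(** * Forests with prescribed roots *)

(** Spanning forests with exactly one vertex of K, the root, in each component. Unlike spanning
    trees they can be counted by turning roots into ordinary vertices one at a time, and a tree on K
    completes each of them to a spanning tree. *)
Definition forests (G : sgraph) (K : {set G}) : {set {ffun G -> G}} :=
  [set f : {ffun G -> G} | [forall v, if v \in K then f v == v else edge v (f v)]
           && [forall v, exists k in K, fconnect f v k]].

Lemma forestsP (G : sgraph) (K : {set G}) (f : {ffun G -> G}) :
  reflect [/\ {in K, forall v, f v = v},
              forall v, v \notin K -> edge v (f v)
            & forall v, exists2 k, k \in K & fconnect f v k] (f \in forests K).
Proof.
rewrite inE; apply: (iffP andP) => [[/forallP h1 /forallP h2]|[h1 h2 h3]].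
  split => [v vK|v vK|v]; last by have /exists_inP := h2 v.
    by have := h1 v; rewrite vK => /eqP.
  by have := h1 v; rewrite (negbTE vK).
split; last by apply/forallP => v; apply/exists_inP; have [k] := h3 v; exists k.
by apply/forallP => v; case: ifPn => [/h1->//|/h2].
Qed.

Lemma forests_acyclic (G : sgraph) (K : {set G}) (f : {ffun G -> G}) (v : G) :
  f \in forests K -> v \notin K -> ~~ fconnect f (f v) v.
Proof.
move=> /forestsP[f1 _ f3] vK; have [k kK vk] := f3 v.
apply: (fconnect_not_periodic vk (f1 _ kK)).
by apply: contraNneq vK => ->.
Qed.

Lemma forests_upd (G : sgraph) (K : {set G}) (f : {ffun G -> G}) (v y : G) :
  f \in forests K -> v \notin K -> edge v y -> ~~ fconnect f y v -> upd f v y \in forests K.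
Proof.
move=> fF vK vy nyv; have /forestsP[f1 f2 f3] := fF.
have v' : fconnect (upd f v y) v y by apply/fconnect_iterP; exists 1; rewrite /= upd_same.
have y' : exists2 k, k \in K & fconnect (upd f v y) y k.
  by have [k kK yk] := f3 y; exists k => //; rewrite fconnect_upd.
apply/forestsP; split.
- by move=> w wK; rewrite upd_other ?f1 //; apply: contraNneq vK => <-.
- by move=> w wK; case: (eqVneq w v) => [->|wv]; rewrite ?upd_same // upd_other // f2.
- move=> w; case: (boolP (fconnect f w v)) => [/fconnect_iterP[k kw]|nwv].
    suff wv : fconnect (upd f v y) w v.
      by have [k' kK yk] := y'; exists k' => //; apply: connect_trans wv (connect_trans v' yk).
    elim: k w kw => [w /= -> //|k IH w]; rewrite iterSr; case: (eqVneq w v) => [-> //|wv] /IH h.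
    by apply: connect_trans h; rewrite -(upd_other f y wv); apply: fconnect1.
  by have [k kK wk] := f3 w; exists k => //; rewrite fconnect_upd.
Qed.

Lemma forests_upd_root (G : sgraph) (K : {set G}) (f : {ffun G -> G}) (w y : G) :
  f \in forests (w |: K) -> w \notin K -> edge w y -> ~~ fconnect f y w ->
  upd f w y \in forests K.
Proof.
move=> fF wK wy nyw; have /forestsP[f1 f2 f3] := fF.
have w' : fconnect (upd f w y) w y by apply/fconnect_iterP; exists 1; rewrite /= upd_same.
have off x : ~~ fconnect f x w -> exists2 k, k \in K & fconnect (upd f w y) x k.
  move=> nxw; have [k] := f3 x; rewrite !inE => /orP[/eqP->|kK xk]; first by rewrite (negbTE nxw).
  by exists k => //; rewrite fconnect_upd.
apply/forestsP; split.
- by move=> x xK; rewrite upd_other ?f1 ?inE ?xK ?orbT //; apply: contraNneq wK => <-.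
- move=> x xK; case: (eqVneq x w) => [->|xw]; rewrite ?upd_same // upd_other // f2 //.
  by rewrite !inE negb_or xw.
- move=> x; case: (boolP (fconnect f x w)) => [/fconnect_iterP[k kx]|]; last exact: off.
  suff xw : fconnect (upd f w y) x w.
    by have [k' kK yk] := off _ nyw; exists k' => //; apply: connect_trans xw (connect_trans w' yk).
  elim: k x kx => [x /= -> //|k IH x]; rewrite iterSr; case: (eqVneq x w) => [-> //|xw] /IH h.
  by apply: connect_trans h; rewrite -(upd_other f y xw); apply: fconnect1.
Qed.

(* Exchanging the parent of v for another neighbour y is an involution on the
   pairs (f, y) such that y does not lead to v, and it shows that the number of
   forests in which a vertex leads to w is harmonic at v. *)
Lemma leading_harmonic (G : sgraph) (K : {set G}) (v w : G) : v \notin K -> w \in K ->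
  degree v * #|[set f in forests K | fconnect f v w]|
  <= \sum_(y | edge v y) #|[set f in forests K | fconnect f y w]|.
Proof.
move=> vK wK.
pose A : {set {ffun G -> G} * G} := [set p | [&& p.1 \in forests K, fconnect p.1 v w & edge v p.2]].
pose B : {set {ffun G -> G} * G} := [set p | [&& p.1 \in forests K, fconnect p.1 p.2 w & edge v p.2]].
have -> : \sum_(y | edge v y) #|[set f in forests K | fconnect f y w]| = #|B|.
  rewrite -sum1_card (partition_big (fun p : {ffun G -> G} * G => p.2) (edge v)) /=; last first.
    by move=> p; rewrite inE => /and3P[].
  apply: eq_bigr => y vy; rewrite sum1dep_card -[LHS](card_imset _ (f := fun f : {ffun G -> G} => (f, y))); last by move=> f g [].
  apply: eq_card => -[f z]; rewrite [in RHS]inE /=; apply/imsetP/andP => [[g]|].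
    by rewrite inE => /andP[gF gy] [-> ->]; rewrite inE /= gF gy vy.
  rewrite inE /= => -[/and3P[fF fz vz] /eqP zy]; subst z.
  by exists f => //; rewrite inE fF.
have -> : degree v * #|[set f in forests K | fconnect f v w]| = #|A|.
  rewrite mulnC /degree -cardsX; apply: eq_card => -[f y].
  by rewrite !inE /= andbA.
(* If y leads to v, the exchange would close a cycle, so the pair is left alone; y then leads to w
   through v. *)
pose psi (p : {ffun G -> G} * G) := if fconnect p.1 p.2 v then p else (upd p.1 v p.2, p.1 v).
have psiK : {in A, cancel psi psi}.
  move=> [f y]; rewrite inE /= => /and3P[fF fv vy]; rewrite /psi /=.
  case: (boolP (fconnect f y v)) => /= [->//|nyv].
  rewrite fconnect_upd; last exact: forests_acyclic fF vK.
  by rewrite (negbTE (forests_acyclic fF vK)) upd_same upd_upd upd_id.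
rewrite -(card_in_imset (can_in_inj psiK)); apply: subset_leq_card.
apply/subsetP => q /imsetP[[f y]]; rewrite inE /= => /and3P[fF fv vy] ->.
have /forestsP[f1 f2 f3] := fF.
rewrite /psi /=; case: (boolP (fconnect f y v)) => yv.
  by rewrite inE /= fF vy (connect_trans yv fv).
rewrite inE /= forests_upd // f2 // andbT fconnect_upd; last exact: forests_acyclic fF vK.
have /fconnect_iterP[[|k]] := fv; first by move=> /= vw; rewrite -vw (negbTE vK) in wK.
by rewrite iterSr => kE; apply/fconnect_iterP; exists k.
Qed.

(* Maximum principle: leading_harmonic at a vertex v where the count is maximal,
   t of whose neighbours are roots other than w. *)
Lemma leading_bound (G : sgraph) (K : {set G}) (t : nat) (w v : G) :
  w \notin K -> (forall v, v \notin K -> t <= #|nb K v|) -> v != w ->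
  t * #|[set f in forests (w |: K) | fconnect f v w]| <= #|forests (w |: K)|.
Proof.
move=> wK tK vw; set K' := w |: K.
pose h v := #|[set f in forests K' | fconnect f v w]|.
have h0 k : k \in K -> h k = 0.
  move=> kK; apply/eqP; rewrite cards_eq0; apply: contraT => /set0Pn[f].
  move=> /setIdP[/forestsP[f1 _ _] /fconnect_iterP[j]].
  rewrite iter_fixed ?f1 ?inE ?kK ?orbT // => kw.
  by rewrite -kw kK in wK.
have [x xw xmax] : exists2 x, x != w & forall y, y != w -> h y <= h x.
  by case: (arg_maxnP h (P := predC1 w) vw) => x xw xm; exists x.
apply: (@leq_trans (t * h x)); first by rewrite leq_mul2l xmax ?orbT.
case: (boolP (x \in K)) => xK; first by rewrite h0 // muln0.
have xK' : x \notin K' by rewrite !inE negb_or xw.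
have wK' : w \in K' by rewrite !inE eqxx.
have := leading_harmonic xK' wK'; rewrite -/(h x).
have tot : degree x = #|nb K x| + #|nb (~: K) x|.
  rewrite -nbT -(cardsID K (nb [set: G] x)); congr (_ + _); apply: eq_card => y; rewrite !inE.
    by rewrite andbC.
  by rewrite andbC.
have hw : h w = #|forests K'|.
  by rewrite /h; apply: eq_card => f; rewrite !inE connect0 andbT.
(* Neighbours in K contribute 0 and w contributes at most one full count; all others are at most
   [h x]. Against [degree x * h x] on the other side, only the neighbours in K survive
   cancellation. *)
have : \sum_(y | edge x y) h y <= #|forests K'| + #|nb (~: K) x| * h x.
  rewrite (bigID (mem K)) /= big1 ?add0n; last by move=> y /andP[_ yK]; apply: h0.
  apply: (@leq_trans (\sum_(y in nb (~: K) x) (h x + (y == w) * #|forests K'|))).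
    rewrite [X in _ <= X](eq_bigl (fun y => edge x y && (y \notin K))); last first.
      by move=> y; rewrite !inE andbC.
    apply: leq_sum => y /andP[xy yK]; case: eqP => [->|/eqP yw]; last by rewrite addn0 xmax.
    by rewrite hw mul1n leq_addl.
  rewrite big_split /= sum_nat_const addnC leq_add2r -big_distrl /=.
  rewrite -[X in _ <= X]mul1n leq_mul2r; apply/orP; right.
  rewrite -big_mkcondr sum1_card /=.
  by rewrite -(card1 w); apply: subset_leq_card; apply/subsetP => y; rewrite !inE => /andP[].
move=> le1 le2; have := leq_trans le2 le1; rewrite tot mulnDl leq_add2r.
apply: leq_trans; rewrite leq_mul2r tK ?orbT //.
Qed.

(* A forest rooted at w |: K becomes one rooted at K when w gets a parent y that
   does not lead to w, and few neighbours y of w lead to w. *)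
Lemma forests_step (G : sgraph) (K : {set G}) (t : nat) (w : G) :
  w \notin K -> (forall v, v \notin K -> t <= #|nb K v|) ->
  t.-1 * (degree w * #|forests (w |: K)|) <= t * #|forests K|.
Proof.
move=> wK tK; set K' := w |: K.
case: t tK => [|t] tK //=.
pose A : {set {ffun G -> G} * G} := setX (forests K') (nb [set: G] w).
pose B : {set {ffun G -> G} * G} := [set p in A | fconnect p.1 p.2 w].
have cA : #|A| = degree w * #|forests K'| by rewrite cardsX nbT mulnC.
have cB : t.+1 * #|B| <= #|A|.
  have -> : #|B| = \sum_(y in nb [set: G] w) #|[set f in forests K' | fconnect f y w]|.
    rewrite -sum1_card (partition_big (fun p : {ffun G -> G} * G => p.2) (mem (nb [set: G] w))) /=; last first.
      by move=> [f y] /setIdP[/setXP[]].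
    apply: eq_bigr => y yw; rewrite sum1dep_card -[RHS](card_imset _ (f := fun f : {ffun G -> G} => (f, y))); last by move=> f g [].
    apply: eq_card => -[f z]; apply/setIdP/imsetP.
      move=> -[/setIdP[/setXP[/= fF fz] zw] /eqP zy]; subst z.
      by exists f => //; rewrite inE fF.
    by move=> [g /setIdP[gF gy] [-> ->]]; split=> //; rewrite in_set in_setX /= gF yw.
  rewrite cA -nbT big_distrr /= -sum_nat_const; apply: leq_sum => y.
  rewrite !inE /= => wy; apply: leading_bound => //.
  by apply: contraTneq wy => ->; rewrite edge_irrefl.
have cAB : #|A| <= #|B| + #|forests K|.
  rewrite -(cardsID B A) leq_add ?subset_leq_card ?subsetIr //.
  pose glue (p : {ffun G -> G} * G) := upd p.1 w p.2.
  have inj : {in A :\: B &, injective glue}.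
    move=> [f y] [g z] /setDP[/setXP[/= /forestsP[f1 _ _] _] _] /setDP[/setXP[/= /forestsP[g1 _ _] _] _].
    rewrite /glue /= => E; have yz : y = z by rewrite -(upd_same f w y) E upd_same.
    congr (_, _) => //; have <- : upd (upd f w y) w w = f.
      by rewrite upd_upd -{2}(f1 w) ?upd_id // !inE eqxx.
    by rewrite E upd_upd -{2}(g1 w) ?upd_id // !inE eqxx.
  rewrite -(card_in_imset inj); apply: subset_leq_card; apply/subsetP => q /imsetP[[f y]].
  move=> /setDP[/setXP[/= fF]]; rewrite in_set in_setT /= => wy nB ->.
  apply: forests_upd_root => //; apply: contra nB => yw.
  by rewrite in_set in_setX /= fF in_set in_setT /= wy.
rewrite -cA -(leq_add2l #|A|) -mulSn.
apply: leq_trans (leq_mul (leqnn t.+1) cAB) _.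
by rewrite mulnDr leq_add2r.
Qed.

(** Cleared of denominators: at least a fraction (1 - 1/t)^|~: K| of the parent choices outside K
    are forests. Iterates [forests_step] from the case where every vertex is a root and the identity
    is a forest. *)
Lemma forests_lb (G : sgraph) (K : {set G}) (t : nat) :
  (forall v, v \notin K -> t <= #|nb K v|) ->
  t.-1 ^ #|~: K| * \prod_(v in ~: K) degree v <= t ^ #|~: K| * #|forests K|.
Proof.
move: {2}#|~: K| (erefl #|~: K|) => j; elim: j K => [|j IH] K jE tK.
  have KE : ~: K = set0 by apply/eqP; rewrite -cards_eq0 jE.
  rewrite KE cards0 big_set0 !expn0 !mul1n card_gt0; apply/set0Pn.
  have inK v : v \in K by rewrite -[K]setCK KE setC0 inE.
  exists [ffun v => v]; apply/forestsP; split => [v _|v|v]; first by rewrite ffunE.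
    by rewrite inK.
  by exists v => //.
have /card_gt0P[w] : 0 < #|~: K| by rewrite jE.
rewrite inE => wK; set K' := w |: K.
have CE : ~: K' = ~: K :\ w by rewrite /K' setCU setIC setDE.
have jE' : #|~: K'| = j.
  by move: jE; rewrite (cardsD1 w) inE wK add1n CE => -[].
have tK' v : v \notin K' -> t <= #|nb K' v|.
  rewrite !inE negb_or => /andP[_ vK]; apply: leq_trans (tK v vK) _.
  by apply/subset_leq_card/nb_sub/subsetUr.
rewrite (big_setD1 w) ?inE //= -CE jE !expnS.
have := IH K' jE' tK'; rewrite jE' => IHK.
have st := forests_step wK tK.
rewrite -!mulnA; apply: (@leq_trans (t.-1 * (degree w * (t ^ j * #|forests K'|)))).
  by rewrite leq_mul2l mulnCA leq_mul2l IHK !orbT.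
by rewrite (mulnCA (degree w)) (mulnCA t.-1) (mulnCA t) leq_mul2l st orbT.
Qed.

(** Completing every forest by one fixed tree on its root set is injective. *)
Lemma forests_le_tau (G : sgraph) (K : {set G}) : 0 < tau K -> #|forests K| <= tau [set: G].
Proof.
case: (set_0Vmem K) => [->|[r rK]]; first by rewrite tau0.
rewrite (tauE rK) => /card_gt0P[g gT]; rewrite (tauE (in_setT r)).
have /treemapsP[g1 g2 g3] := gT.
pose glue (f : {ffun G -> G}) : {ffun G -> G} := [ffun v => if v \in K then g v else f v].
have inj : {in forests K &, injective glue}.
  move=> f f' /forestsP[f1 _ _] /forestsP[f1' _ _] /ffunP E; apply/ffunP => v.
  by have := E v; rewrite !ffunE; case: ifP => // vK; rewrite f1 // f1'.
rewrite -(card_in_imset inj); apply: subset_leq_card; apply/subsetP => _ /imsetP[f fF ->].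
have /forestsP[f1 f2 f3] := fF; apply/treemapsP; split.
- move=> v; rewrite !inE andbT ffunE => vr; case: (boolP (v \in K)) => vK; last exact: f2.
  by have := g1 v; rewrite !inE vr vK => /(_ isT) /andP[].
- by move=> v; rewrite !inE negb_and negbK orbF => /eqP->; rewrite ffunE rK g2 // !inE eqxx.
move=> v _.
have inK k : k \in K -> fconnect (glue f) k r.
  move=> kK; have /fconnect_iterP[q qE] := g3 k kK; apply/fconnect_iterP; exists q.
  rewrite -qE; elim: q k kK {qE} => // q IH k kK; rewrite !iterSr ffunE kK IH //.
  exact: (treemaps_inU rK gT kK).
have [k kK /fconnect_iterP[q qE]] := f3 v.
elim: q v qE => [v /= ->|q IH v]; first exact: inK.
rewrite iterSr => /IH; case: (boolP (v \in K)) => vK _h; first exact: inK.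
apply: connect_trans _h; apply/fconnect_iterP; exists 1.
by rewrite /= ffunE (negbTE vK).
Qed.

(** * Small connected cores *)

Lemma tau_add_gt0 (G : sgraph) (U : {set G}) (u v : G) :
  0 < tau U -> u \in U -> edge v u -> 0 < tau (v |: U).
Proof.
move=> U0 uU vu; case: (boolP (v \in U)) => vU; first by rewrite (setUidPr _) ?sub1set.
apply: leq_trans (tau_add vU); rewrite muln_gt0 U0; apply/card_gt0P.
by exists u; rewrite inE uU.
Qed.

Lemma tau1_gt0 (G : sgraph) (v : G) : 0 < tau [set v].
Proof.
rewrite (tauE (set11 v)); apply/card_gt0P; exists [ffun x => x]; apply/treemapsP; split.
- by move=> x; rewrite !inE => /andP[/negbTE->].
- by move=> x _; rewrite ffunE.
- by move=> x /set1P->.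
Qed.

(* A vertex at distance two from K has a neighbour in S or lies in S, so three
   new vertices suffice to reach a further vertex of S. *)
Lemma connect_dominating (G : sgraph) (S : {set G}) : connected G -> S != set0 ->
  (forall v, v \notin S -> 0 < #|nb S v|) ->
  exists K : {set G}, [/\ S \subset K, #|K| <= 3 * #|S| & 0 < tau K].
Proof.
move=> con /set0Pn[s sS] dom.
suff H j (K : {set G}) : #|S :\: K| <= j -> 0 < tau K ->
    exists K' : {set G}, [/\ S \subset K', #|K'| <= #|K| + 3 * j & 0 < tau K'].
  have [|K [SK Kc K0]] := H #|S|.-1 [set s] _ (tau1_gt0 s).
    by rewrite (cardsD1 s S) sS.
  exists K; split=> //; apply: leq_trans Kc _; rewrite cards1.
  have : 0 < #|S| by apply/card_gt0P; exists s.
  lia.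
elim: j K => [|j IH] K Sj K0.
  exists K; split=> //; last by rewrite leq_addr.
  by rewrite -setD_eq0 -cards_eq0 -leqn0.
case: (set_0Vmem (S :\: K)) => [SK|[u /setDP[uS uK]]].
  by exists K; split=> //; [rewrite -setD_eq0 SK|rewrite leq_addr].
suff [K1 [KK1 [a [aS aK aK1]] c1 t1]] : exists K1 : {set G},
    [/\ K \subset K1, exists a, [/\ a \in S, a \notin K & a \in K1],
        #|K1| <= #|K| + 3 & 0 < tau K1].
  have [|K' [SK' c' t']] := IH K1 _ t1.
    rewrite -ltnS; apply: leq_trans Sj; apply: proper_card.
    apply/properP; split; first exact: setDS.
    by exists a; rewrite inE ?aS ?aK ?aK1.
  by exists K'; split=> //; apply: leq_trans c' _; lia.
have cU1 x (A : {set G}) : #|x |: A| <= #|A|.+1 by rewrite cardsU1; case: (x \in A).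
case: (boolP [exists a in S :\: K, 0 < #|nb K a|]) => [/exists_inP[a]|].
  move=> /setDP[aS aK] /card_gt0P[b]; rewrite inE => /andP[bK ab].
  exists (a |: K); split; rewrite ?subsetUr //.
  - by exists a; rewrite aS aK setU11.
  - by apply: leq_trans (cU1 _ _) _; lia.
  - exact: tau_add_gt0 bK ab.
rewrite negb_exists_in => /forall_inP no.
(* No vertex of S outside K touches K, so u is outside the closed neighbourhood N, and connectivity
   yields y at distance two from K, reached through x. If y is not in S, a neighbour a of y in S is
   the new vertex. *)
pose N := K :|: [set v | 0 < #|nb K v|].
have N0 : N != set0.
  apply: contraTneq K0 => NE; rewrite -leqNgt.
  suff -> : K = set0 by rewrite tau0.
  by apply/eqP; rewrite -subset0 -NE subsetUl.
have uN : u \notin N by rewrite !inE negb_or uK no // inE uK.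
have NT : N != setT by apply: contraNneq uN => ->.
have [y yN /card_gt0P[x]] := connected_nb con N0 NT.
rewrite inE => /andP[xN yx].
have [yK y0] : y \notin K /\ ~~ (0 < #|nb K y|) by move: yN; rewrite !inE negb_or => /andP[].
have xK : x \notin K.
  by apply: contra y0 => xK; apply/card_gt0P; exists x; rewrite inE xK.
have x0 : 0 < #|nb K x| by move: xN; rewrite !inE (negbTE xK).
have [b bK xb] : exists2 b, b \in K & edge x b.
  by have /card_gt0P[b] := x0; rewrite inE => /andP[bK xb]; exists b.
have tx := tau_add_gt0 K0 bK xb.
have ty := tau_add_gt0 tx (setU11 x K) yx.
case: (boolP (y \in S)) => yS.
  exists (y |: (x |: K)); split=> //.
  - by rewrite setUA subsetUr.
  - by exists y; rewrite yS yK setU11.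
  - apply: leq_trans (cU1 _ _) _; rewrite (addnS _ 2) ltnS.
    by apply: leq_trans (cU1 _ _) _; rewrite -addn1 leq_add2l.
have /card_gt0P[a] := dom y yS; rewrite inE => /andP[aS ya].
have aK : a \notin K.
  by apply: contra y0 => aK; apply/card_gt0P; exists a; rewrite inE aK.
exists (a |: (y |: (x |: K))); split.
- by rewrite !setUA subsetUr.
- by exists a; rewrite aS aK setU11.
- apply: leq_trans (cU1 _ _) _; rewrite (addnS _ 2) ltnS.
  apply: leq_trans (cU1 _ _) _; rewrite (addnS _ 1) ltnS.
  by apply: leq_trans (cU1 _ _) _; rewrite addn1.
- by apply: tau_add_gt0 ty (setU11 y _) _; rewrite edge_sym.
Qed.

Local Open Scope ring_scope.
Local Open Scope complex_scope.

(* Greedy choice of S: among the vertices outside S, some one is adjacent to at least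
   the average weight. *)
Lemma cover_weights (R : realFieldType) (G : sgraph) (D k : nat) : (0 < #|G|)%N ->
  (forall v : G, (D <= degree v)%N) -> (2 * k <= D)%N ->
  exists2 S : {set G}, #|S| = k
    & \sum_(v : G) 2^-1 ^+ #|nb S v| <= #|G|%:R * (1 - D%:R / (4 * #|G|%:R)) ^+ k :> R.
Proof.
move=> n0 deg; elim: k => [|k IH] kD.
  exists set0; first by rewrite cards0.
  rewrite expr0 mulr1 -sum1_card natr_sum; apply: ler_sum => v _.
  suff -> : nb set0 v = set0 by rewrite cards0 expr0.
  by apply/setP => y; rewrite !inE.
have [|S Sk SW] := IH; first by lia.
(* Each neighbour put into S halves the weight of v, so a small total weight forces every vertex to
   have many neighbours in S. *)
pose w v : R := 2^-1 ^+ #|nb S v|.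
pose W := \sum_v w v.
have w0 v : 0 <= w v by apply: exprn_ge0; lra.
have W0 : 0 <= W by apply: sumr_ge0.
pose n := #|G|; have nR : 0 < n%:R :> R by rewrite ltr0n.
have D0 : (0 < D)%N by lia.
have degS v : D%:R / 2 <= #|nb (~: S) v|%:R :> R.
  have h : (D <= #|nb (~: S) v| + k)%N.
    apply: leq_trans (deg v) _; rewrite -nbT -(cardsID (~: S)) leq_add //.
      by apply: subset_leq_card; apply/subsetP => y; rewrite !inE andbC.
    by rewrite -Sk; apply: subset_leq_card; apply/subsetP => y; rewrite !inE negbK => /andP[].
  have : (D <= 2 * #|nb (~: S) v|)%N by lia.
  by rewrite -(ler_nat R) natrM; lra.
have [u uS uW] : exists2 u, u \notin S & D%:R / 2 * W / n%:R <= \sum_(v | edge u v) w v.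
  apply/exists_inP; rewrite -[X in is_true X]negbK negb_exists_in; apply/negP => /forall_inP no.
  have lt : \sum_(u in ~: S) \sum_(v | edge u v) w v < \sum_(u in ~: S) D%:R / 2 * W / n%:R.
    apply: ltr_sum; last by move=> u; rewrite inE => /no; rewrite -ltNge.
    have [g _] : exists g : G, true by have /card_gt0P[g] := n0; exists g.
    have : 0 < #|nb (~: S) g|%:R :> R by apply: lt_le_trans (degS g); rewrite divr_gt0 ?ltr0n.
    rewrite ltr0n => /card_gt0P[u]; rewrite inE => /andP[uS _].
    by apply/hasP; exists u; rewrite ?mem_index_enum.
  have : \sum_(u in ~: S) \sum_(v | edge u v) w v >= D%:R / 2 * W.
    rewrite (exchange_big_dep xpredT) //= /W mulr_sumr; apply: ler_sum => v _.
    rewrite sumr_const -[X in _ <= X]mulr_natl ler_wpM2r //.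
    apply: le_trans (degS v) _; rewrite ler_nat; apply: subset_leq_card.
    apply/subsetP => y; rewrite !inE => /andP[yS vy].
    by rewrite unfold_in /= inE yS edge_sym.
  move/le_lt_trans => /(_ _ lt); rewrite sumr_const -[X in _ < X]mulr_natl.
  apply/negP; rewrite -leNgt.
  have -> : #|~: S|%:R * (D%:R / 2 * W / n%:R) = D%:R / 2 * W * (#|~: S|%:R / n%:R) :> R by ring.
  apply: ler_piMr; first by rewrite mulr_ge0 ?divr_ge0 ?ler0n.
  by rewrite ler_pdivrMr // mul1r ler_nat max_card.
exists (u |: S); first by rewrite cardsU1 uS Sk.
have -> : \sum_v 2^-1 ^+ #|nb (u |: S) v| = W - 2^-1 * \sum_(v | edge u v) w v.
  rewrite /W [X in _ = _ - _ * X]big_mkcond /= mulr_sumr -sumrB; apply: eq_bigr => v _.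
  have -> : #|nb (u |: S) v| = (edge u v + #|nb S v|)%N.
    rewrite (cardsD1 u) !inE eqxx edge_sym /=; congr (_ + _)%N; apply: eq_card => y; rewrite !inE.
    by case: (eqVneq y u) => [->|_] //=; rewrite (negbTE uS).
  by case: (edge u v); rewrite ?add0n ?mulr0 ?subr0 // add1n exprS /w; lra.
rewrite exprSr mulrA; set q := 1 - _.
have q0 : 0 <= q.
  rewrite /q subr_ge0 ler_pdivrMr ?mulr_gt0 // ?ltr0n // mul1r.
  have : D%:R <= n%:R :> R.
    have /card_gt0P[g _] := n0; rewrite ler_nat; apply: leq_trans (deg g) _.
    by rewrite /degree max_card.
  by rewrite -/n; lra.
apply: le_trans (ler_wpM2r q0 SW); rewrite -/W.
have -> : W * q = W - 2^-1 * (D%:R / 2 * W / n%:R).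
  rewrite /q -/n; field; by rewrite lt0r_neq0.
by rewrite lerD2l lerN2 ler_wpM2l // invr_ge0.
Qed.

(** * Bounded differences *)

(** Squaring 1 - x/2 <= exp (- x/2) gives exp x <= (1 - x/2)^-2. With the denominator cleared, the
    gap to the claim is x^2 (1 - x) (5/4 - x/2). *)
Lemma expR_le_quad (R : realType) (x : R) : `|x| <= 1 -> expR x <= 1 + x + 2 * x ^+ 2.
Proof.
rewrite ler_norml => /andP[x1 x2].
have h : 0 < 1 - x / 2 by lra.
have e1 : 1 - x / 2 <= expR (- (x / 2)) by apply: expR_ge1Dx.
have e2 : (1 - x / 2) ^+ 2 <= expR (- x).
  have -> : - x = - (x / 2) + - (x / 2) by lra.
  by rewrite expRD -expr2 lerXn2r ?nnegrE ?expR_ge0 // ltW.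
have -> : expR x = (expR (- x))^-1 by rewrite expRN invrK.
rewrite -div1r ler_pdivrMr ?expR_gt0 //.
have q0 : 0 <= 1 + x + 2 * x ^+ 2 by nra.
apply: le_trans (ler_wpM2l q0 e2).
have : 0 <= x ^+ 2 * ((1 - x) * (5 / 4 - x / 2)).
  by rewrite mulr_ge0 ?sqr_ge0 // mulr_ge0; lra.
by rewrite -subr_ge0; congr (0 <= _); field.
Qed.

(** Conditional expectation: the value at v is resampled uniformly from S v, the others are kept. *)
Definition avg (R : realType) (T U : finType) (S : T -> {set U}) (v : T)
    (X : {ffun T -> U} -> R) (f : {ffun T -> U}) : R :=
  (\sum_(y in S v) X (upd f v y)) / #|S v|%:R.

Section Averages.
Context {R : realType} {T U : finType} (S : T -> {set U}).
Hypothesis S0 : forall v, (0 < #|S v|)%N.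
Implicit Type X : {ffun T -> U} -> R.

Let Sn v : 0 < #|S v|%:R :> R. Proof. by rewrite ltr0n. Qed.

Lemma avg_le v X Y f : (forall f, X f <= Y f) -> avg S v X f <= avg S v Y f.
Proof.
move=> XY; rewrite /avg ler_pM2r ?invr_gt0 //; exact: ler_sum.
Qed.

Lemma avg_const v (a : R) f : avg S v (fun _ => a) f = a.
Proof. by rewrite /avg sumr_const -(mulr_natr a) mulfK // gt_eqF. Qed.

Lemma avg_scale v X (a : R) f : avg S v (fun f => a * X f) f = a * avg S v X f.
Proof. by rewrite /avg -mulr_sumr mulrA. Qed.

Lemma sum_avg v X :
  \sum_(f in family S) avg S v X f = \sum_(f in family S) X f.
Proof.
rewrite /avg -mulr_suml.
suff -> : \sum_(f in family S) \sum_(y in S v) X (upd f v y) = #|S v|%:R * \sum_(f in family S) X f.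
  by rewrite mulrC mulKf // gt_eqF.
have -> : #|S v|%:R * \sum_(f in family S) X f = \sum_(f in family S) \sum_(y in S v) X f.
  by rewrite mulr_sumr; apply: eq_bigr => f _; rewrite sumr_const mulr_natl.
rewrite !pair_big_dep /=.
(* Swapping f v with y is an involution on the pairs with f in the family and y in S v. *)
pose psi (p : {ffun T -> U} * U) := (upd p.1 v p.2, p.1 v).
have psiK : cancel psi psi by move=> [f y]; rewrite /psi /= upd_same upd_upd upd_id.
rewrite [RHS](reindex psi) /=; last by exists psi => p _; apply: psiK.
apply: eq_bigl => -[f y] /=.
apply/andP/andP => -[/familyP fF yS]; split.
- by apply/familyP => x; rewrite ffunE; case: eqP => [->|_].
- exact: fF.
- apply/familyP => x; have := fF x; rewrite ffunE; case: eqP => // -> _; exact: yS.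
- by have := fF v; rewrite upd_same.
Qed.

Definition osc_le (c : R) X := forall f v y z, `|X (upd f v y) - X (upd f v z)| <= c.

Lemma avg_osc c v X : 0 <= c -> osc_le c X -> osc_le c (avg S v X).
Proof.
move=> c0 Xc f w a b; case: (eqVneq w v) => [->|wv].
  rewrite /avg; under eq_bigr do rewrite upd_upd.
  by under [X in _ - X / _]eq_bigr do rewrite upd_upd; rewrite subrr normr0.
rewrite /avg -mulrBl -sumrB normrM [X in _ * X]ger0_norm ?invr_ge0 ?ler0n //.
rewrite ler_pdivrMr // mulr_natr -sumr_const; apply: le_trans (ler_norm_sum _ _ _) _.
by apply: ler_sum => y _; rewrite !(upd_comm _ _ _ wv).
Qed.

Definition indep_of X (A : {set T}) :=
  forall f g : {ffun T -> U}, (forall v, v \notin A -> f v = g v) -> X f = X g.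

Lemma avg_indep v X A : indep_of X A -> indep_of (avg S v X) (v |: A).
Proof.
move=> XA f g fg; rewrite /avg; congr (_ / _); apply: eq_bigr => y _.
apply: XA => x xA; rewrite !ffunE; case: eqP => // /eqP xv; apply: fg.
by rewrite !inE negb_or xv.
Qed.

Definition avgs (s : seq T) X := foldr (avg S) X s.

Lemma avgs_indep s X : indep_of (avgs s X) [set x in s].
Proof.
elim: s => [|v s IH] /=.
  by move=> f g fg; congr X; apply/ffunP => v; apply: fg; rewrite inE.
by rewrite set_cons; apply: avg_indep.
Qed.

Lemma avgs_osc c s X : 0 <= c -> osc_le c X -> osc_le c (avgs s X).
Proof. by move=> c0 Xc; elim: s => //= v s IH; apply: avg_osc. Qed.

Lemma sum_avgs s X : \sum_(f in family S) avgs s X f = \sum_(f in family S) X f.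
Proof. by elim: s => //= v s IH; rewrite sum_avg. Qed.

Lemma avgs_bounded s X (b : R) :
  (forall f, 0 <= X f <= b) -> forall f, 0 <= avgs s X f <= b.
Proof.
move=> Xb; elim: s => //= v s IH f; apply/andP; split.
  by rewrite -(avg_const v 0 f); apply: avg_le => g; case/andP: (IH g).
by rewrite -[X in _ <= X](avg_const v b f); apply: avg_le => g; case/andP: (IH g).
Qed.

(** The deviation of X from its average has mean 0 and size at most c, so the linear term of
    [expR_le_quad] averages out and 1 + 2 (t c)^2 remains. *)
Lemma avg_mgf c t v X f : osc_le c X -> `|t| * c <= 1 ->
  avg S v (fun f => expR (t * X f)) f <= expR (2 * (t * c) ^+ 2) * expR (t * avg S v X f).
Proof.
move=> Xc tc; set m := avg S v X f.
have mE : \sum_(y in S v) (X (upd f v y) - m) = 0.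
  by rewrite sumrB sumr_const -(mulr_natr m) /m /avg divfK ?subrr // gt_eqF.
have dev y : y \in S v -> `|X (upd f v y) - m| <= c.
  move=> yS; have -> : X (upd f v y) - m =
      (\sum_(z in S v) (X (upd f v y) - X (upd f v z))) / #|S v|%:R.
    by rewrite sumrB sumr_const -(mulr_natr (X _)) mulrBl mulfK // gt_eqF.
  rewrite normrM [X in _ * X]ger0_norm ?invr_ge0 ?ler0n // ler_pdivrMr // mulr_natr -sumr_const.
  by apply: le_trans (ler_norm_sum _ _ _) _; apply: ler_sum => z _; apply: Xc.
rewrite /avg ler_pdivrMr //.
have -> : expR (2 * (t * c) ^+ 2) * expR (t * m) * #|S v|%:R =
    expR (t * m) * (expR (2 * (t * c) ^+ 2) * #|S v|%:R) by ring.
have -> : \sum_(y in S v) expR (t * X (upd f v y)) =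
    expR (t * m) * \sum_(y in S v) expR (t * (X (upd f v y) - m)).
  rewrite mulr_sumr; apply: eq_bigr => y _; rewrite -expRD; congr expR; ring.
rewrite ler_wpM2l ?expR_ge0 //.
apply: (@le_trans _ _ (\sum_(y in S v) (1 + t * (X (upd f v y) - m) + 2 * (t * c) ^+ 2))).
  apply: ler_sum => y yS; have d1 := dev y yS.
  have c0 : 0 <= c by apply: le_trans d1.
  have d2 : `|t * (X (upd f v y) - m)| <= `|t| * c by rewrite normrM ler_wpM2l.
  apply: le_trans (expR_le_quad (le_trans d2 tc)) _; rewrite lerD2l ler_wpM2l //.
  rewrite -(real_normK (num_real (t * _))) -(real_normK (num_real (t * c))).
  by rewrite lerXn2r ?nnegrE // [X in _ <= X]normrM (ger0_norm c0).
rewrite big_split big_split /= -mulr_sumr mE mulr0 addr0 !sumr_const -mulrnDl -(mulr_natr (_ + _)).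
by rewrite ler_wpM2r ?ler0n // expR_ge1Dx.
Qed.

Lemma avgs_mgf c t s X f : 0 <= c -> osc_le c X -> `|t| * c <= 1 ->
  avgs s (fun f => expR (t * X f)) f
  <= expR (2 * (t * c) ^+ 2 * (size s)%:R) * expR (t * avgs s X f).
Proof.
move=> c0 Xc tc; elim: s f => [|v s IH] f /=; first by rewrite mulr0 expR0 mul1r.
apply: le_trans (avg_le v f IH) _; rewrite avg_scale.
apply: le_trans (ler_wpM2l (expR_ge0 _) (avg_mgf v f (avgs_osc s c0 Xc) tc)) _.
rewrite mulrA.
have -> : (size s).+1%:R = (size s)%:R + 1 :> R by rewrite natr1.
by rewrite mulrDr mulr1 expRD.
Qed.

(* Bounded differences (McDiarmid), in exponential moment form; the constant m is
   the mean of X on the product of the S v. *)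
Lemma product_mgf (c b : R) X : 0 <= c -> osc_le c X -> (forall f, 0 <= X f <= b) ->
  exists2 m, 0 <= m <= b & forall t, `|t| * c <= 1 ->
  \sum_(f in family S) expR (t * (X f - m)) <= expR (2 * (t * c) ^+ 2 * #|T|%:R) * #|family S|%:R.
Proof.
move=> c0 Xc Xb.
have [f0 _] : exists f0 : {ffun T -> U}, true.
  have S1 v : exists y, y \in S v by apply/card_gt0P.
  have [g _] := choice S1; by exists [ffun v => g v].
(* Averaged over all coordinates, X is constant, so its value at an arbitrary f0 is the mean. *)
exists (avgs (enum T) X f0); first exact: avgs_bounded.
set m := avgs _ _ _; move=> t tc.
have mE f : avgs (enum T) X f = m.
  by apply: avgs_indep => v; rewrite inE mem_enum.
under eq_bigr do rewrite mulrBr expRD.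
rewrite -mulr_suml expRN ler_pdivrMr ?expR_gt0 //.
rewrite -(sum_avgs (enum T)) mulrAC [X in _ <= X]mulr_natr -sumr_const; apply: ler_sum => f _.
apply: le_trans (avgs_mgf _ _ c0 Xc tc) _.
by rewrite mE cardE.
Qed.

(** Markov's inequality for t and - t, one for each tail. The parameter t stays free, to be
    optimised in the application. *)
Lemma product_concentration (c b : R) X : 0 < c -> osc_le c X -> (forall f, 0 <= X f <= b) ->
  exists2 m, 0 <= m <= b & forall t d, 0 <= t -> t * c <= 1 ->
  #|[set f in family S | d < `|X f - m|]|%:R
  <= 2 * expR (2 * (t * c) ^+ 2 * #|T|%:R - t * d) * #|family S|%:R.
Proof.
move=> c0 Xc Xb; have [m mb mgf] := product_mgf (ltW c0) Xc Xb.
exists m => // t d t0 tc.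
have tn : `|t| = t by apply: ger0_norm.
have m1 := mgf t; have m2 := mgf (- t).
rewrite tn in m1; rewrite normrN tn mulNr sqrrN in m2.
have {m1 m2} [m1 m2] := (m1 tc, m2 tc).
rewrite expRD expRN mulrA mulrAC ler_pdivlMr ?expR_gt0 //.
rewrite [X in _ <= X](_ : _ = expR (2 * (t * c) ^+ 2 * #|T|%:R) * #|family S|%:R
  + expR (2 * (t * c) ^+ 2 * #|T|%:R) * #|family S|%:R); last by ring.
apply: le_trans (lerD m1 m2); rewrite -big_split /=.
rewrite [X in X * _ <= _](_ : _ = \sum_(f in [set f in family S | d < `|X f - m|]) 1 :> R); last first.
  by rewrite sumr_const.
rewrite mulr_suml [X in X <= _](eq_bigl (fun f => (f \in family S) && (d < `|X f - m|))); last first.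
  by move=> f; rewrite inE.
rewrite big_mkcondr /=; apply: ler_sum => f _.
case: ifP => [|_]; last by rewrite addr_ge0 ?expR_ge0.
rewrite mul1r.
case: (ger0P (X f - m)) => s dX.
  by rewrite -[X in X <= _]addr0 lerD ?expR_ge0 // ler_expR ler_wpM2l // ltW.
by rewrite -[X in X <= _]add0r lerD ?expR_ge0 // ler_expR mulNr -mulrN ler_wpM2l // ltW.
Qed.
End Averages.

(** * Complex exponential *)

Lemma normr_sin_le (R : realType) (x : R) : `|sin x| <= `|x|.
Proof.
wlog x0 : x / 0 < x.
  move=> H; case: (ltrgt0P x) => [x0|x0|->]; last by rewrite sin0 normr0.
    by have := H x x0; rewrite (gtr0_norm x0).
  by have := H (- x); rewrite oppr_gt0 sinN !normrN (ltr0_norm x0) => /(_ x0).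
have [c _] := @MVT R sin cos 0 x x0 (fun c _ => is_derive_sin c)
  (continuous_subspaceT (@continuous_sin R)).
rewrite sin0 !subr0 => ->; rewrite normrM ler_piMl //; exact: cos_max.
Qed.

Lemma one_sub_cos_le (R : realType) (x : R) : 0 <= 1 - cos x <= x ^+ 2 / 2.
Proof.
rewrite subr_ge0 cos_le1 /=.
have -> : cos x = cos (x / 2 *+ 2) by congr cos; rewrite mulr2n -splitr.
rewrite cos_mulr2n cos2sin2.
have : sin (x / 2) ^+ 2 <= (x / 2) ^+ 2.
  rewrite -(real_normK (num_real (sin _))) -(real_normK (num_real (x / 2))).
  by rewrite lerXn2r ?nnegrE // normr_sin_le.
rewrite -[(1 - _) *+ 2]mulr_natr => h.
have e : (x / 2) ^+ 2 = x ^+ 2 / 4 by field.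
by move: h; rewrite e; lra.
Qed.

Lemma sin_sub_le (R : realType) (x : R) : `|x| <= 1 -> `|sin x - x| <= x ^+ 2 / 2.
Proof.
wlog x0 : x / 0 < x.
  move=> H x1; case: (ltrgt0P x) => [x0|x0|->].
  - exact: H.
  - have := H (- x); rewrite oppr_gt0 sinN normrN sqrrN => /(_ x0 x1).
    by rewrite -opprD normrN.
  - by rewrite sin0 subr0 normr0 expr0n /= mul0r.
rewrite (gtr0_norm x0) => x1.
have [c cI] := @MVT R sin cos 0 x x0 (fun c _ => is_derive_sin c)
  (continuous_subspaceT (@continuous_sin R)).
rewrite sin0 !subr0 => ->; rewrite -[X in _ - X]mul1r -mulrBl normrM distrC.
have /andP[c0 c1] := one_sub_cos_le c.
rewrite (ger0_norm c0) (gtr0_norm x0).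
move: cI; rewrite in_itv /= => /andP[cp cx].
have : c ^+ 2 <= x ^+ 2 by rewrite lerXn2r ?nnegrE // ltW.
nra.
Qed.

Import ComplexField.Normc.

Section ComplexExp.
Context {R : realType}.
Implicit Types u v : R[i].

Lemma normc_ge0 u : 0 <= normc u.
Proof. by case: u => a b; apply: sqrtr_ge0. Qed.

Lemma norm_normc u : `|u| = (normc u)%:C.
Proof. by []. Qed.

Lemma normcD u v : normc (u + v) <= normc u + normc v.
Proof. exact: le_normcD. Qed.

Lemma normcN u : normc (- u) = normc u.
Proof. exact: complex.normcN. Qed.

Lemma normc_real (x : R) : normc x%:C = `|x|.
Proof. by rewrite /normc /= expr0n /= addr0 sqrtr_sqr. Qed.

Lemma normcX u k : normc (u ^+ k) = normc u ^+ k.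
Proof. by elim: k => [|k IH]; rewrite ?expr0 ?normc1 // !exprS normcM IH. Qed.

Lemma normc_nat n : normc (n%:R : R[i]) = n%:R.
Proof. by rewrite -(rmorph_nat (real_complex R)) normc_real ger0_norm ?ler0n. Qed.

Lemma normc_sum (I : Type) (s : seq I) (P : pred I) (F : I -> R[i]) :
  normc (\sum_(i <- s | P i) F i) <= \sum_(i <- s | P i) normc (F i).
Proof.
elim/big_rec2: _ => [|i x y _ IH]; first by rewrite normc0.
by apply: le_trans (normcD _ _) _; rewrite lerD2l.
Qed.

Lemma normc_prod (I : Type) (s : seq I) (P : pred I) (F : I -> R[i]) :
  normc (\prod_(i <- s | P i) F i) = \prod_(i <- s | P i) normc (F i).
Proof. by elim/big_rec2: _ => [|i x y _ <-]; rewrite ?normc1 ?normcM. Qed.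

Lemma Re_le u : `|complex.Re u| <= normc u.
Proof.
case: u => a b; rewrite /= -(sqrtr_sqr a) ler_sqrt ?addr_ge0 ?sqr_ge0 //.
by rewrite lerDl sqr_ge0.
Qed.

Lemma Im_le u : `|complex.Im u| <= normc u.
Proof.
case: u => a b; rewrite /= -(sqrtr_sqr b) ler_sqrt ?addr_ge0 ?sqr_ge0 //.
by rewrite lerDr sqr_ge0.
Qed.

Lemma normc_le_sum (a b : R) : normc (a +i* b) <= `|a| + `|b|.
Proof.
have -> : (a +i* b) = a%:C + 'i * b%:C by simpc.
apply: le_trans (normcD _ _) _; rewrite normcM !normc_real.
by rewrite /normc /= expr0n /= expr1n add0r sqrtr1 mul1r.
Qed.

Definition cexp u : R[i] :=
  (expR (complex.Re u) * cos (complex.Im u)) +i* (expR (complex.Re u) * sin (complex.Im u)).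

Lemma cexpD u v : cexp (u + v) = cexp u * cexp v.
Proof.
case: u v => [a b] [c d]; rewrite /cexp /=; simpc; rewrite expRD cosD sinD.
by congr (_ +i* _); ring.
Qed.

Lemma normc_cexp u : normc (cexp u) = expR (complex.Re u).
Proof.
case: u => [a b]; rewrite /cexp /= !exprMn -mulrDr cos2Dsin2 mulr1 sqrtr_sqr.
by rewrite ger0_norm ?expR_ge0.
Qed.

Lemma cexp0 : cexp 0 = 1.
Proof. by rewrite /cexp /= expR0 cos0 sin0 mulr1 mulr0. Qed.

Lemma cexpK u : cexp u * cexp (- u) = 1.
Proof. by rewrite -cexpD subrr cexp0. Qed.

Lemma cexp_sum (I : Type) (s : seq I) (P : pred I) (F : I -> R[i]) :
  cexp (\sum_(i <- s | P i) F i) = \prod_(i <- s | P i) cexp (F i).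
Proof. by elim/big_rec2: _ => [|i x y _ <-]; rewrite ?cexp0 ?cexpD. Qed.

Lemma cexp_taylor u : normc u <= 1 -> normc (cexp u - 1 - u) <= 4 * normc u ^+ 2.
Proof.
move=> u1; have a1 := le_trans (Re_le u) u1; have b1 := le_trans (Im_le u) u1.
have n2 : normc u ^+ 2 = complex.Re u ^+ 2 + complex.Im u ^+ 2.
  by case: (u) => a b /=; rewrite sqr_sqrtr ?addr_ge0 ?sqr_ge0.
rewrite n2; move: a1 b1; case: u {u1 n2} => a b a1 b1; rewrite [complex.Re _]/= in a1 *; rewrite [complex.Im _]/= in b1 *.
have -> : cexp (a +i* b) - 1 - (a +i* b) =
    (expR a * cos b - 1 - a) +i* (expR a * sin b - b).
  by rewrite /cexp /= -[1]/((1 : R)%:C) /real_complex_def; simpc.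
apply: le_trans (normc_le_sum _ _) _.
have e1 := expR_le_quad a1; have e2 := expR_ge1Dx a; have e0 := expR_gt0 a.
have /andP[c0 c1] := one_sub_cos_le b; have s1 := sin_sub_le b1.
have s2 := normr_sin_le b.
have a2 : a ^+ 2 <= 1 by rewrite -(real_normK (num_real a)) expr_le1.
have aa : a <= 1 by apply: le_trans (ler_norm a) a1.
(* Each piece of the two splittings is quadratically small: a remainder of exp, cos or sin, or a
   product of two linearly small terms. *)
have -> : expR a * cos b - 1 - a = (expR a - 1 - a) - expR a * (1 - cos b) by ring.
have -> : expR a * sin b - b = (expR a - 1) * sin b + (sin b - b) by ring.
have r1 : `|(expR a - 1 - a) - expR a * (1 - cos b)| <= 2 * a ^+ 2 + 4 * (b ^+ 2 / 2).
  apply: le_trans (ler_normB _ _) _; apply: lerD.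
    by rewrite ger0_norm; lra.
  rewrite normrM (gtr0_norm e0) (ger0_norm c0) ler_pM ?(ltW e0) //; lra.
have r2 : `|(expR a - 1) * sin b + (sin b - b)| <= 3 * `|a| * `|b| + b ^+ 2 / 2.
  apply: le_trans (ler_normD _ _) _; apply: lerD => //.
  rewrite normrM ler_pM //.
  have -> : expR a - 1 = (expR a - 1 - a) + a by ring.
  apply: le_trans (ler_normD _ _) _; rewrite ger0_norm; last by lra.
  have : a ^+ 2 <= `|a| by rewrite -(real_normK (num_real a)) expr2 ler_piMl.
  lra.
have ab : 2 * `|a| * `|b| <= a ^+ 2 + b ^+ 2.
  rewrite -(real_normK (num_real a)) -(real_normK (num_real b)).
  have := sqr_ge0 (`|a| - `|b|); nra.
have := sqr_ge0 b; have := sqr_ge0 a; lra.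
Qed.

Lemma cexp_near1 u : normc u <= 1 -> normc (cexp u - 1) <= 5 * normc u.
Proof.
move=> u1; have -> : cexp u - 1 = (cexp u - 1 - u) + u by ring.
apply: le_trans (normcD _ _) _; have := cexp_taylor u1.
have := normc_ge0 u; nra.
Qed.

(** The cost of replacing 1 + u by exp u. Here 9 = 4 * 2 + 1, from [cexp_taylor], |1 + u| <= 2 and
    the leftover u^2. *)
Lemma cexpN_1D u : normc u <= 1 -> normc (cexp (- u) * (1 + u) - 1) <= 9 * normc u ^+ 2.
Proof.
move=> u1; have Nu1 : normc (- u) <= 1 by rewrite normcN.
have -> : cexp (- u) * (1 + u) - 1 = (cexp (- u) - 1 - (- u)) * (1 + u) + - (u ^+ 2) by ring.
apply: le_trans (normcD _ _) _; rewrite normcM normcN normcX.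
have := cexp_taylor Nu1; rewrite normcN.
have n1 : normc (1 + u) <= 2 by apply: le_trans (normcD _ _) _; rewrite normc1; lra.
have := normc_ge0 (1 + u); have := normc_ge0 (cexp (- u) - 1 - - u); have := sqr_ge0 (normc u).
nra.
Qed.

(** Since 1 + |x y - 1| <= (1 + |x - 1|) (1 + |y - 1|), and 1 + d <= exp d. *)
Lemma normc_prod_near1 (I : Type) (s : seq I) (P : pred I) (F : I -> R[i]) :
  normc (\prod_(i <- s | P i) F i - 1) <= expR (\sum_(i <- s | P i) normc (F i - 1)) - 1.
Proof.
elim/big_rec2: _ => [|i x y Pi IH]; first by rewrite subrr normc0 expR0 subrr.
have -> : F i * y - 1 = (F i - 1) * (y - 1) + ((F i - 1) + (y - 1)) by ring.
apply: le_trans (normcD _ _) _; rewrite normcM.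
apply: le_trans (lerD (lexx _) (normcD _ _)) _.
set d := normc (F i - 1); set e := normc (y - 1).
have d0 : 0 <= d by apply: normc_ge0.
have e0 : 0 <= e by apply: normc_ge0.
rewrite expRD; have := expR_ge1Dx d; set E := expR d; set X := expR x => dE.
have eX : e + 1 <= X by rewrite -lerBrDr.
have : (1 + d) * (e + 1) <= E * X by rewrite ler_pM //; lra.
lra.
Qed.
End ComplexExp.

(** * Sums over leaf sets *)

Lemma prod_1D_subsets (R : comPzRingType) (T : finType) (L : {set T}) (c : T -> R) :
  \prod_(a in L) (1 + c a) = \sum_(A : {set T} | A \subset L) \prod_(a in A) c a.
Proof.
rewrite big_mkcond /=.
rewrite (eq_bigr (fun a => (if a \in L then c a else 0) + 1)); last first.
  by move=> a _; case: ifP; rewrite ?add0r // addrC.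
rewrite bigA_distr [in RHS]big_mkcond /=; apply: eq_bigr => A _.
case: ifPn => AL; last first.
  have /subsetPn[x xA xL] := AL.
  by rewrite (bigD1 x) //= xA (negbTE xL) mul0r.
rewrite [in RHS]big_mkcond /=; apply: eq_bigr => a _; case: ifP => // aA.
by rewrite (subsetP AL).
Qed.

Lemma sum_exp_card (R : comPzRingType) (T : finType) (y : R) :
  \sum_(A : {set T}) y ^+ #|A| = (1 + y) ^+ #|T|.
Proof.
have := prod_1D_subsets [set: T] (fun _ => y).
rewrite prodr_const cardsT => ->; rewrite [RHS]big_mkcond /=; apply: eq_bigr => A _.
by rewrite subsetT prodr_const.
Qed.

Lemma sum_exp_card_mem (R : comPzRingType) (T : finType) (r : T) (y : R) :
  \sum_(A : {set T} | r \in A) y ^+ #|A| = y * (1 + y) ^+ #|T|.-1.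
Proof.
have := prod_1D_subsets [set~ r] (fun _ => y); rewrite prodr_const cardsC1 => ->.
rewrite mulr_sumr (reindex_onto (fun A => r |: A) (fun A => A :\ r)) /=; last first.
  by move=> A rA; rewrite setD1K.
apply: eq_big => [A|A].
  rewrite setU11 -setTD subsetD1 subsetT /=.
  apply/eqP/idP => [<-|rA]; first by rewrite !inE eqxx.
  by rewrite setU1K.
move=> /andP[_ /eqP rA]; have : r \notin A by rewrite -rA !inE eqxx.
by move=> rA'; rewrite cardsU1 rA' exprS prodr_const.
Qed.

Lemma subtree_poly_root (R : realType) (G : sgraph) (x : R[i]) : x != 0 ->
  root (subtree_poly R[i] G) x -> \sum_(A : {set G}) (tau (~: A))%:R * x^-1 ^+ #|A| = 0.
Proof.
move=> x0 /rootP xr.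
have xn : x ^+ #|G| != 0 by rewrite expf_neq0.
apply: (mulIf xn); rewrite mul0r -[RHS]xr /subtree_poly mulr_suml.
rewrite (reindex_inj (@setC_inj G)) /=.
rewrite horner_sum big_add1 /= big_mkord.
rewrite (eq_bigr (fun U : {set G} => (tau U)%:R * x ^+ #|U|)); last first.
  move=> U _; rewrite setCK -mulrA; congr (_ * _).
  by rewrite -(cardsC U) exprD mulrCA exprVn mulVf ?mulr1 // expf_neq0.
have cU (U : {set G}) : (#|U| < #|G|.+1)%N by rewrite ltnS max_card.
rewrite (partition_big (fun U : {set G} => Ordinal (cU U)) xpredT) //= big_ord_recl /=.
(* The empty vertex set gives the term k = 0, which is missing in the polynomial and where [tau]
   vanishes. *)
rewrite big1 ?add0r; last first.
  move=> U /eqP[U0]; suff -> : U = set0 by rewrite tau0 mul0r.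
  by apply/eqP; rewrite -cards_eq0 U0.
apply: eq_bigr => k _; rewrite hornerZ hornerXn num_subtreesE natr_sum mulr_suml.
apply: eq_big => [U|U /eqP[->]] //.
Qed.

(* The vertices outside the image of a parent map are the leaves other than the root. *)
Definition leafpoly (R : realType) (G : sgraph) (f : {ffun G -> G}) (z : R[i]) : R[i] :=
  \prod_(a in ~: (f @: [set: G])) (1 + z / (degree a)%:R).

(** An exact identity, by [card_treemaps_into]; all approximation is in the ratios, which are 1 -
    O(|A| / D). Sets A containing r are absent because r is its own parent and so never outside the
    image. *)
Lemma sum_leafpoly (R : realType) (G : sgraph) (r : G) (z : R[i]) :
  \sum_(f in treemaps r [set: G]) leafpoly f z =
  \sum_(A : {set G} | r \notin A)
     (tau (~: A))%:R * z ^+ #|A| * \prod_(a in A) (#|nb (~: A) a|%:R / (degree a)%:R).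
Proof.
under eq_bigr do rewrite /leafpoly prod_1D_subsets.
rewrite (exchange_big_dep xpredT) //= [RHS]big_mkcond /=; apply: eq_bigr => A _.
rewrite sumr_const.
case: ifPn => rA; last first.
  rewrite negbK in rA; rewrite eq_card0 ?mulr0n // => f; rewrite unfold_in /=.
  apply/negP => /andP[/treemapsP[_ f2 _] /subsetP/(_ r rA)]; rewrite inE => /negP; apply.
  by apply/imsetP; exists r => //; rewrite f2 // !inE eqxx.
rewrite (eq_card (B := mem [set f in treemaps r [set: G] | [forall v in [set: G], f v \in ~: A]])); last first.
  move=> f; rewrite [LHS]unfold_in [RHS]in_set; congr (_ && _).
  apply/subsetP/forall_inP => h v.
    move=> _; rewrite inE; apply: contraTN (imset_f f (in_setT v)) => /h; by rewrite inE.
  by move=> vA; rewrite inE; apply/negP => /imsetP[w wT vw]; have := h w wT; rewrite -vw inE vA.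
have rU : r \in ~: A by rewrite inE.
rewrite (card_treemaps_into rU (subsetT _)) setTD setCK.
rewrite -[LHS]mulr_natl natrM natr_prod -!mulrA; congr (_ * _).
rewrite -prodr_const -!big_split /=; apply: eq_bigr => a _; ring.
Qed.

Lemma one_sub_prod_le (R : realDomainType) (I : finType) (A : {set I}) (x : I -> R) :
  (forall a, 0 <= x a <= 1) -> 0 <= 1 - \prod_(a in A) x a <= \sum_(a in A) (1 - x a).
Proof.
move=> x01.
suff H : [/\ 0 <= \prod_(a in A) x a, \prod_(a in A) x a <= 1
    & 1 - \prod_(a in A) x a <= \sum_(a in A) (1 - x a)].
  by case: H => _ h1 ->; rewrite subr_ge0 h1.
elim/big_rec2: _ => [|a p q _ [p0 p1 pq]]; first by rewrite subrr.
have /andP[x0 x1] := x01 a; split; [exact: mulr_ge0|exact: mulr_ile1|].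
have : 0 <= (1 - x a) * (1 - q) by rewrite mulr_ge0 ?subr_ge0.
lra.
Qed.

(** Replaces the factor |A|^2 of the error by an exponential, so that the sum over A remains
    binomial. *)
Lemma sqrn_le_exp2 j : (j ^ 2 <= 2 * 2 ^ j)%N.
Proof.
elim: j => // j IH; case: (leqP 3 j) => j3; last by case: j j3 {IH} => [|[|[|]]].
rewrite (expnS 2 j); apply: leq_trans (leq_mul (leqnn 2) IH); rewrite -!mulnn; nia.
Qed.

(* The sets A containing r, and the ratios nb / degree, account for the term
   y / b and for the term 2 / D respectively; b ^- m bounds the large sets A. *)
Lemma sum_leafpoly_error (R : realType) (G : sgraph) (r : G) (D m : nat) (z : R[i]) (y b : R) :
  connected G -> (forall v : G, (D <= degree v)%N) -> (m < D)%N ->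
  y = normc z -> b = (D - m)%:R ->
  normc (\sum_(A : {set G}) (tau (~: A))%:R * z ^+ #|A|
         - \sum_(f in treemaps r [set: G]) leafpoly f z)
  <= (tau [set: G])%:R * ((2 / D%:R + y / b) * (1 + 2 * (y / b)) ^+ #|G|
                          + (2 / D%:R + y) * (b ^- m * (1 + 2 * y) ^+ #|G|)).
Proof.
move=> con deg mD yE bE.
have D0 : 0 < D%:R :> R by rewrite ltr0n; lia.
have b0 : 0 < b by rewrite bE ltr0n subn_gt0.
have b1 : 1 <= b by rewrite bE ler1n subn_gt0.
have y0 : 0 <= y by rewrite yE; apply: normc_ge0.
set Y := y / b; have Y0 : 0 <= Y by rewrite divr_ge0 // ltW.
pose q (A : {set G}) a : R := #|nb (~: A) a|%:R / (degree a)%:R.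
have dR (a : G) : 0 < (degree a)%:R :> R by apply: lt_le_trans D0 _; rewrite ler_nat deg.
have q01 A a : 0 <= q A a <= 1.
  rewrite /q divr_ge0 ?ler0n //= ler_pdivrMr // mul1r ler_nat -nbT.
  by apply/subset_leq_card/nb_sub/subsetT.
(* The relative difference of the two terms for A; it is 1 when r is in A, where the second sum has
   no term. *)
pose om (A : {set G}) : R := if r \in A then 1 else 1 - \prod_(a in A) q A a.
have omle A : 0 <= om A <= (r \in A)%:R + 2 / D%:R * 2 ^+ #|A|.
  have e0 : 0 <= 2 / D%:R * 2 ^+ #|A| :> R.
    by rewrite mulr_ge0 ?divr_ge0 ?exprn_ge0 // ltW.
  rewrite /om; case: ifP => rA; first by rewrite ler01 lerDl.
  rewrite add0r; have /andP[-> h] := one_sub_prod_le A (q01 A); rewrite (le_trans h) //.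
  apply: (@le_trans _ _ (\sum_(a in A) (#|A|%:R / D%:R))).
    apply: ler_sum => a aA.
    have h1 : (degree a <= #|nb (~: A) a| + #|A|)%N.
      rewrite -nbT -(cardsID (~: A) (nb [set: G] a)) leq_add //; apply: subset_leq_card.
        by apply/subsetP => x; rewrite !inE andbC.
      by apply/subsetP => x; rewrite !inE negbK => /andP[].
    have -> : 1 - q A a = ((degree a)%:R - #|nb (~: A) a|%:R) / (degree a)%:R.
      by rewrite mulrBl divff ?gt_eqF.
    apply: ler_pM; rewrite ?invr_ge0 ?ler0n //.
    - by rewrite subr_ge0 ler_nat -nbT; apply/subset_leq_card/nb_sub/subsetT.
    - by rewrite lerBlDl -natrD ler_nat.
    - by rewrite lef_pV2 ?posrE // ler_nat.
  rewrite sumr_const -[X in X <= _]mulr_natl mulrA -natrM mulnn mulrAC ler_pM2r ?invr_gt0 //.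
  by rewrite -natrX -natrM ler_nat sqrn_le_exp2.
(* [tau_lb] gives the first summand if |A| <= m and the second otherwise; adding both avoids
   splitting the sum over A. *)
have tauA (A : {set G}) : (tau (~: A))%:R <= (tau [set: G])%:R * (b ^- #|A| + b ^- m) :> R.
  case: (eqVneq (~: A) set0) => [->|A0].
    by rewrite tau0 mulr_ge0 ?addr_ge0 ?invr_ge0 ?exprn_ge0 ?ler0n // ltW.
  have := tau_lb m con deg A0; rewrite setCK -(ler_nat R) natrM natrX -bE.
  rewrite -ler_pdivlMr ?exprn_gt0 // => /le_trans; apply; rewrite ler_wpM2l ?ler0n //.
  by case: (leqP #|A| m) => _; rewrite ?lerDl ?lerDr invr_ge0 exprn_ge0 // ltW.
rewrite sum_leafpoly [X in _ - X]big_mkcond -sumrB.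
apply: le_trans (normc_sum _ _ _) _.
apply: (@le_trans _ _ (\sum_(A : {set G}) (tau [set: G])%:R * (b ^- #|A| + b ^- m) *
    y ^+ #|A| * ((r \in A)%:R + 2 / D%:R * 2 ^+ #|A|))).
  apply: ler_sum => A _.
  have -> : (tau (~: A))%:R * z ^+ #|A| - (if r \notin A then
      (tau (~: A))%:R * z ^+ #|A| * \prod_(a in A) (#|nb (~: A) a|%:R / (degree a)%:R) else 0)
      = (tau (~: A))%:R * z ^+ #|A| * (om A)%:C.
    rewrite /om; case: (boolP (r \in A)) => rA /=; first by rewrite subr0 rmorph1 mulr1.
    rewrite rmorphB rmorph1 rmorph_prod mulrBr mulr1; congr (_ - _ * _).
    by apply: eq_bigr => a _; rewrite /q fmorph_div !rmorph_nat.
  have /andP[om0 om1] := omle A.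
  rewrite !normcM normc_nat normcX normc_real (ger0_norm om0) -yE.
  rewrite !ler_pM ?mulr_ge0 ?exprn_ge0 ?ler0n //.
have -> : \sum_(A : {set G}) (tau [set: G])%:R * (b ^- #|A| + b ^- m) *
    y ^+ #|A| * ((r \in A)%:R + 2 / D%:R * 2 ^+ #|A|) =
  (tau [set: G])%:R * ((\sum_(A : {set G} | r \in A) Y ^+ #|A| + 2 / D%:R * \sum_(A : {set G}) (2 * Y) ^+ #|A|)
   + b ^- m * (\sum_(A : {set G} | r \in A) y ^+ #|A| + 2 / D%:R * \sum_(A : {set G}) (2 * y) ^+ #|A|)).
  rewrite [\sum_(A : {set G} | r \in A) Y ^+ _]big_mkcond [\sum_(A : {set G} | r \in A) y ^+ _]big_mkcond /=.
  rewrite !mulr_sumr -!big_split /= !mulr_sumr -big_split mulr_sumr /=; apply: eq_bigr => A _.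
  by rewrite /Y !exprMn exprVn; case: (r \in A) => /=; ring.
rewrite !sum_exp_card !sum_exp_card_mem ler_wpM2l ?ler0n //.
have pw (x : R) : 0 <= x -> (1 + x) ^+ #|G|.-1 <= (1 + 2 * x) ^+ #|G|.
  move=> x0; apply: (@le_trans _ _ ((1 + 2 * x) ^+ #|G|.-1)).
    by rewrite lerXn2r ?nnegrE //; lra.
  by rewrite ler_weXn2l ?leq_pred //; lra.
have bm : 0 <= b ^- m by rewrite invr_ge0 exprn_ge0 // ltW.
apply: lerD.
  by rewrite [X in _ <= X]mulrDl [X in _ <= X]addrC lerD2r ler_wpM2l // pw.
rewrite mulrCA ler_wpM2l // [X in _ <= X]mulrDl [X in _ <= X]addrC lerD2r ler_wpM2l //.
exact: pw.
Qed.

(** * Leaf weights and the exponential approximation *)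

Definition leafweight (R : realType) (G : sgraph) (f : {ffun G -> G}) : R :=
  \sum_(a in ~: (f @: [set: G])) (degree a)%:R^-1.

Lemma leafpoly_cexp (R : realType) (G : sgraph) (D : nat) (z : R[i]) (mu del : R) (f : {ffun G -> G}) :
  (0 < D)%N -> (forall v : G, (D <= degree v)%N) ->
  normc z <= D%:R -> normc z * del <= 1 -> `|leafweight R f - mu| <= del ->
  normc (cexp (- (z * mu%:C)) * leafpoly f z - 1)
  <= expR (9 * #|G|%:R * (normc z / D%:R) ^+ 2 + 5 * (normc z * del)) - 1.
Proof.
move=> D0 deg zD zdel fdel; set L := ~: (f @: [set: G]); set y := normc z in zD zdel *.
have DR : 0 < D%:R :> R by rewrite ltr0n.
have y0 : 0 <= y by apply: normc_ge0.
pose u (a : G) : R[i] := z / (degree a)%:R.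
have uy a : normc (u a) <= y / D%:R.
  rewrite /u normcM normcV normc_nat ler_wpM2l // lef_pV2 ?posrE ?ltr0n ?ler_nat //.
  exact: leq_trans (deg a).
have yD1 : y / D%:R <= 1 by rewrite ler_pdivrMr // mul1r.
have u1 a : normc (u a) <= 1 by apply: le_trans (uy a) yD1.
set w := z * (leafweight R f - mu)%:C.
have ny : normc w <= y * del by rewrite /w normcM normc_real ler_wpM2l.
have -> : cexp (- (z * mu%:C)) * leafpoly f z =
    cexp w * \prod_(a in L) (cexp (- u a) * (1 + u a)).
  rewrite big_split /= -cexp_sum sumrN mulrA -cexpD; congr (cexp _ * _).
  rewrite /w /leafweight rmorphB rmorph_sum mulrBr mulr_sumr.
  rewrite [X in _ = X - _ + _](_ : _ = \sum_(a in L) u a); first by ring.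
  by apply: eq_bigr => a _; rewrite /u fmorphV rmorph_nat.
set P := \prod_(a in L) _.
have nP : normc (P - 1) <= expR (9 * #|G|%:R * (y / D%:R) ^+ 2) - 1.
  apply: le_trans (normc_prod_near1 _ _ _) _; rewrite lerD2r ler_expR.
  apply: (@le_trans _ _ (\sum_(a in L) 9 * (y / D%:R) ^+ 2)).
    apply: ler_sum => a _; apply: le_trans (cexpN_1D (u1 a)) _; rewrite ler_wpM2l //.
    by rewrite lerXn2r ?nnegrE ?normc_ge0 // divr_ge0 // ltW.
  rewrite sumr_const -[X in X <= _]mulr_natl mulrCA mulrA ler_wpM2r ?sqr_ge0 //.
  by rewrite ler_wpM2l // ler_nat max_card.
have nw : normc (cexp w - 1) <= expR (5 * (y * del)) - 1.
  apply: le_trans (cexp_near1 (le_trans ny zdel)) _.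
  apply: (@le_trans _ _ (5 * (y * del))); first by rewrite ler_wpM2l.
  by rewrite lerBrDl expR_ge1Dx.
have -> : cexp w * P - 1 = (cexp w - 1) * (P - 1) + ((cexp w - 1) + (P - 1)) by ring.
apply: le_trans (normcD _ _) _; rewrite normcM.
apply: le_trans (lerD (lexx _) (normcD _ _)) _; rewrite expRD.
move: nP nw; set d := normc (cexp w - 1); set e := normc (P - 1).
set E := expR _; set X := expR _ => eE dX.
have d0 : 0 <= d by apply: normc_ge0.
have e0 : 0 <= e by apply: normc_ge0.
have : (1 + d) * (1 + e) <= X * E by rewrite ler_pM //; lra.
lra.
Qed.

Lemma leafweight_bounds (R : realType) (G : sgraph) (D : nat) (f : {ffun G -> G}) :
  (0 < D)%N -> (forall v : G, (D <= degree v)%N) -> 0 <= leafweight R f <= #|G|%:R / D%:R.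
Proof.
move=> D0 deg; rewrite /leafweight sumr_ge0 /=; last by move=> a _; rewrite invr_ge0.
apply: (@le_trans _ _ (\sum_(a in ~: (f @: [set: G])) D%:R^-1)).
  apply: ler_sum => a _; rewrite lef_pV2 ?posrE ?ltr0n ?ler_nat //.
  exact: leq_trans (deg a).
by rewrite sumr_const -[X in X <= _]mulr_natl ler_wpM2r ?invr_ge0 // ler_nat max_card.
Qed.

Lemma normc_leafpoly_le (R : realType) (G : sgraph) (D : nat) (z : R[i]) (f : {ffun G -> G}) :
  (0 < D)%N -> (forall v : G, (D <= degree v)%N) ->
  normc (leafpoly f z) <= expR (normc z * (#|G|%:R / D%:R)).
Proof.
move=> D0 deg; rewrite /leafpoly normc_prod.
apply: (@le_trans _ _ (\prod_(a in ~: (f @: [set: G])) expR (normc z * (degree a)%:R^-1))).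
  apply: ler_prod => a _; rewrite normc_ge0 /=.
  apply: le_trans (normcD _ _) _; rewrite normc1 normcM normcV normc_nat.
  exact: expR_ge1Dx.
rewrite -expR_sum -mulr_sumr ler_expR ler_wpM2l ?normc_ge0 //.
by have /andP[] := leafweight_bounds R f D0 deg.
Qed.

(* After multiplication by cexp (- z mu) the terms with leaf weight close to mu are
   close to 1, and the others are too few to matter. *)
Lemma sum_leafpoly_lb (R : realType) (G : sgraph) (T : {set {ffun G -> G}}) (D : nat) (z : R[i]) (mu del : R) :
  (0 < D)%N -> (forall v : G, (D <= degree v)%N) ->
  normc z <= D%:R -> normc z * del <= 1 -> 0 <= mu <= #|G|%:R / D%:R ->
  9 * #|G|%:R * (normc z / D%:R) ^+ 2 + 5 * (normc z * del) <= 4^-1 ->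
  #|[set f in T | del < `|leafweight R f - mu|]|%:R * expR (2 * (normc z * (#|G|%:R / D%:R)))
    <= 8^-1 * #|T|%:R ->
  expR (- (normc z * (#|G|%:R / D%:R))) * (3 / 8 * #|T|%:R) <= normc (\sum_(f in T) leafpoly f z).
Proof.
move=> D0 deg zD zdel /andP[mu0 mu1] small bad.
set y := normc z in zD zdel small bad *; set B := [set f in T | _] in bad.
have y0 : 0 <= y by apply: normc_ge0.
set Y := y * (#|G|%:R / D%:R) in bad *.
have Y0 : 0 <= Y by rewrite mulr_ge0 ?divr_ge0.
have ymu : y * mu <= Y by rewrite ler_wpM2l.
have nzmu : normc (z * mu%:C) = y * mu by rewrite normcM normc_real ger0_norm.
pose c := cexp (- (z * mu%:C)).
have nc : expR (- Y) <= normc (cexp (z * mu%:C)) <= expR Y.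
  rewrite normc_cexp !ler_expR; have := Re_le (z * mu%:C); rewrite nzmu ler_norml.
  by move=> /andP[h1 h2]; apply/andP; split; lra.
have nc' : normc c <= expR Y.
  rewrite /c normc_cexp ler_expR; have := Re_le (- (z * mu%:C)); rewrite normcN nzmu ler_norml.
  by move=> /andP[h1 h2]; lra.
set W := \sum_(f in T) _.
have WE : cexp (z * mu%:C) * (c * W) = W by rewrite mulrA /c cexpK mul1r.
have e1 : expR (4^-1) - 1 <= 3 / 8 :> R.
  have := @expR_le_quad R 4^-1; rewrite ger0_norm ?invr_ge0 // => /(_ _)h.
  have : (4^-1 : R) <= 1 by lra.
  by move=> /h; lra.
(* 5/8 = 3/8 + 2/8: a good tree contributes at most exp (1/4) - 1 <= 3/8, a bad one at most 2 exp (2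
   Y), and [bad] limits the latter to 2/8 of #|T| in total. *)
have dist : normc (c * W - #|T|%:R) <= 5 / 8 * #|T|%:R.
  have -> : c * W - #|T|%:R = \sum_(f in T) (c * leafpoly f z - 1).
    by rewrite sumrB -mulr_sumr sumr_const.
  apply: le_trans (normc_sum _ _ _) _.
  apply: (@le_trans _ _ (\sum_(f in T) (3 / 8 + (f \in B)%:R * (2 * expR (2 * Y))))).
    apply: ler_sum => f fT; rewrite inE fT /=; case: ltP => fdel /=.
      rewrite mul1r; apply: le_trans (normcD _ _) _; rewrite normcN normc1 normcM.
      have h1 : normc c * normc (leafpoly f z) <= expR (2 * Y).
        have -> : expR (2 * Y) = expR Y * expR Y by rewrite -expRD; congr expR; ring.
        by rewrite ler_pM ?normc_ge0 // normc_leafpoly_le.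
      have h2 : 1 <= expR (2 * Y) by rewrite -[X in X <= _]expR0 ler_expR mulr_ge0.
      lra.
    rewrite mul0r addr0; apply: le_trans (leafpoly_cexp D0 deg zD zdel fdel) _.
    by apply: le_trans e1; rewrite lerD2r ler_expR.
  rewrite big_split /= -[X in _ + X]mulr_suml sumr_const -(mulr_natr (3 / 8)).
  have -> : \sum_(f in T) (f \in B)%:R = #|B|%:R :> R.
    rewrite -natr_sum -big_mkcondr sum1dep_card /=; congr _%:R; apply: eq_card => f.
    by rewrite !inE andbA andbb.
  by move: bad; set x := expR _; set n := #|T|%:R; set k := #|B|%:R; lra.
have : 3 / 8 * #|T|%:R <= normc (c * W).
  have := normcD (c * W) (#|T|%:R - c * W); rewrite addrC subrK normc_nat -[_ - c * W]opprB normcN.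
  lra.
move=> h; rewrite -WE normcM; case/andP: nc => nc _.
apply: ler_pM => //; first exact: expR_ge0.
by rewrite mulr_ge0 // divr_ge0.
Qed.

(** * Density of spanning trees among parent choices *)

(** The root gets the single choice r, so that parent maps lie in a product over all vertices. *)
Definition choices (G : sgraph) (r v : G) : {set G} :=
  if v == r then [set r] else nb [set: G] v.

Lemma treemaps_choices (G : sgraph) (r : G) (f : {ffun G -> G}) :
  f \in treemaps r [set: G] -> f \in family (choices r).
Proof.
move=> /treemapsP[f1 f2 _]; apply/familyP => v; rewrite /choices; case: eqP => [->|/eqP vr].
  by rewrite f2 !inE ?eqxx.
by apply: f1; rewrite !inE vr.
Qed.

Lemma card_choices_gt0 (G : sgraph) (D : nat) (r v : G) :
  (0 < D)%N -> (forall v : G, (D <= degree v)%N) -> (0 < #|choices r v|)%N.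
Proof.
move=> D0 deg; rewrite /choices; case: eqP => _; first by rewrite cards1.
by rewrite nbT (leq_trans D0).
Qed.

Lemma card_family_choices (G : sgraph) (r : G) (K : {set G}) : r \in K ->
  (#|family (choices r)| <= #|G| ^ #|K| * \prod_(v in ~: K) degree v)%N.
Proof.
move=> rK; rewrite card_family foldrE big_map big_enum /=.
rewrite (bigID (mem K)) /= leq_mul //.
  rewrite -prod_nat_const; apply: leq_prod => v _; exact: max_card.
rewrite [X in (_ <= X)%N](eq_bigl (fun v => v \notin K)); last by move=> v; rewrite inE.
apply: leq_prod => v vK; rewrite /choices; case: eqP => [vr|_]; last by rewrite nbT.
by rewrite vr rK in vK.
Qed.

(** Each vertex of K costs a factor n, and each other vertex costs the factor t / (t - 1) <= exp (1
    / (t - 1)) of [forests_lb]. *)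
Lemma density (R : realType) (G : sgraph) (r : G) (K : {set G}) (t : nat) :
  r \in K -> (0 < tau K)%N -> (1 < t)%N -> (forall v, v \notin K -> (t <= #|nb K v|)%N) ->
  #|family (choices r)|%:R <=
    expR (#|K|%:R * ln #|G|%:R + #|G|%:R / t.-1%:R) * #|treemaps r [set: G]|%:R :> R.
Proof.
move=> rK K0 t1 tK; rewrite -(tauE (in_setT r)).
have n0 : 0 < #|G|%:R :> R by rewrite ltr0n; apply/card_gt0P; exists r.
have t0 : 0 < t.-1%:R :> R by rewrite ltr0n; lia.
set P := (\prod_(v in ~: K) degree v)%N.
have h : P%:R <= expR (#|G|%:R / t.-1%:R) * (tau [set: G])%:R :> R.
  have := leq_trans (forests_lb tK) (leq_mul (leqnn _) (forests_le_tau K0)).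
  rewrite -/P -(ler_nat R) !natrM !natrX mulrC -ler_pdivlMr ?exprn_gt0 // mulrAC => /le_trans; apply.
  rewrite ler_wpM2r // -expr_div_n.
  have -> : t%:R / t.-1%:R = 1 + t.-1%:R^-1 :> R.
    have tE : t = (t.-1 + 1)%N by lia.
    by rewrite {1}tE natrD mulrDl divff ?gt_eqF // mul1r.
  apply: (@le_trans _ _ (expR (t.-1%:R^-1) ^+ #|~: K|)).
    by rewrite lerXn2r ?nnegrE ?expR_ge0 ?expR_ge1Dx // addr_ge0 ?invr_ge0.
  by rewrite -expRM_natl ler_expR ler_wpM2r ?invr_ge0 // ler_nat max_card.
apply: (@le_trans _ _ ((#|G| ^ #|K| * P)%:R)); first by rewrite ler_nat card_family_choices.
rewrite natrM natrX expRD -mulrA; apply: ler_pM => //; first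
  by rewrite exprn_ge0 ?ler0n.
by rewrite expRM_natl lnK // posrE.
Qed.

(** Changing one parent from y to z can change leaf status only at y and z, and each weighs at most
    1/D. *)
Lemma leafweight_osc (R : realType) (G : sgraph) (D : nat) :
  (0 < D)%N -> (forall v : G, (D <= degree v)%N) ->
  osc_le (2 / D%:R) (@leafweight R G).
Proof.
move=> D0 deg f v y z.
have im (w a : G) : a \in (upd f v w @: [set: G]) = (a == w) || (a \in f @: [set~ v]).
  apply/imsetP/orP => [[x _ ->]|[/eqP->|/imsetP[x]]].
  - rewrite ffunE; case: (x =P v) => [_|xv]; [by left|right].
    by apply/imsetP; exists x => //; rewrite !inE; apply/eqP.
  - by exists v => //; rewrite upd_same.
  - by rewrite !inE => xv ->; exists x => //; rewrite upd_other.
have inv (a : G) : (0 <= (degree a)%:R^-1 :> R) && ((degree a)%:R^-1 <= D%:R^-1 :> R).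
  by rewrite invr_ge0 ler0n /= lef_pV2 ?posrE ?ltr0n ?ler_nat // (leq_trans D0).
rewrite /leafweight [X in X - _]big_mkcond [X in _ - X]big_mkcond -sumrB /=.
apply: le_trans (ler_norm_sum _ _ _) _.
apply: (@le_trans _ _ (\sum_a ((a == y)%:R + (a == z)%:R) * D%:R^-1)).
  apply: ler_sum => a _; have /andP[i0 i1] := inv a; rewrite !inE !im.
  by case: (a == y); case: (a == z); case: (a \in f @: _) => /=; rewrite ler_norml; lra.
rewrite -mulr_suml big_split /=.
have one (w : G) : \sum_a (a == w)%:R = 1 :> R.
  by rewrite (bigD1 w) //= eqxx big1 ?addr0 // => a /negbTE->.
by rewrite !one.
Qed.

Lemma core_exists (R : realType) (G : sgraph) (D : nat) (alpha s : R) :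
  connected G -> (forall v : G, (D <= degree v)%N) -> (D <= #|G|)%N -> 0 < alpha <= 1 ->
  #|G|%:R = s ^+ 2 -> alpha * #|G|%:R <= D%:R -> 64 <= alpha * s -> 16 * ln #|G|%:R <= alpha * s ->
  exists K t, [/\ (0 < tau K)%N, (1 < t)%N, forall v : G, v \notin K -> (t <= #|nb K v|)%N
    & #|K|%:R * ln #|G|%:R + #|G|%:R / t.-1%:R <= 3 * s * ln #|G|%:R + 32 * s / alpha].
Proof.
move=> con deg Dn /andP[a0 a1] nE aD as64 lns.
have s64 : 64 <= s.
  have s0 : 0 < s by rewrite -(pmulr_rgt0 _ a0); lra.
  by apply: le_trans as64 _; rewrite ler_piMl // ltW.
have n0 : 0 < #|G|%:R :> R by rewrite nE exprn_gt0; lra.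
have n1 : 1 <= #|G|%:R :> R by rewrite ler1n -(ltr0n R).
have ln0 : 0 <= ln #|G|%:R :> R by apply: ln_ge0.
have s0 : 0 <= s by lra.
pose k := Num.truncn s.
have /andP[ks sk] := truncn_itv s0; rewrite -/k in ks sk.
rewrite -[k.+1%:R]natr1 in sk.
have ak0 : 0 <= alpha * k%:R / 8 by rewrite divr_ge0 ?mulr_ge0 // ltW.
pose t := Num.truncn (alpha * k%:R / 8).
have /andP[tk kt] := truncn_itv ak0; rewrite -/t in tk kt.
rewrite -[t.+1%:R]natr1 in kt.
have ks2 : alpha * s <= 2 * (alpha * k%:R).
  have : alpha * (s / 2) <= alpha * k%:R by rewrite ler_pM2l //; lra.
  lra.
have t3 : 3 <= t%:R + 1 :> R by lra.
have t2 : (1 < t)%N by rewrite -(ltr_nat R); lra.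
have kD : (2 * k <= D)%N.
  rewrite -(ler_nat R) natrM; apply: le_trans aD; rewrite nE.
  have : 2 * s <= alpha * s * s by rewrite ler_wpM2r //; lra.
  by rewrite expr2 mulrA; lra.
have G0 : (0 < #|G|)%N by rewrite -(ltr0n R).
have [S Sk Ssum] := cover_weights R G0 deg kD.
have k0 : (0 < k)%N by rewrite -(ltr0n R); lra.
(* The total weight is at most n exp (- alpha k / 4), and 16 ln n <= alpha s <= 2 alpha k brings
   this down to exp (- alpha k / 8); a single weight is at least exp (- #|nb S v|). *)
have cov v : (t <= #|nb S v|)%N.
  rewrite -(ler_nat R); apply: le_trans tk _.
  set c := #|nb S v|.
  have h1 : expR (- c%:R) <= 2^-1 ^+ c :> R.
    rewrite -mulN1r mulrC expRM_natl lerXn2r ?nnegrE ?expR_ge0 ?invr_ge0 //.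
    by rewrite expRN lef_pV2 ?posrE ?expR_gt0 //; have := expR_ge1Dx (1 : R); lra.
  have h2 : 2^-1 ^+ c <= \sum_v 2^-1 ^+ #|nb S v| :> R.
    rewrite (bigD1 v) //= lerDl sumr_ge0 // => w _; by rewrite exprn_ge0 ?invr_ge0.
  have h3 : (1 - D%:R / (4 * #|G|%:R)) ^+ k <= expR (- (alpha * k%:R / 4)) :> R.
    have -> : - (alpha * k%:R / 4) = k%:R * (- (alpha / 4)) by ring.
    rewrite expRM_natl lerXn2r ?nnegrE ?expR_ge0 //.
      rewrite subr_ge0 ler_pdivrMr ?mulr_gt0 // mul1r.
      have : D%:R <= #|G|%:R :> R by rewrite ler_nat.
      lra.
    apply: le_trans (expR_ge1Dx _); rewrite lerD2l lerN2 ler_pdivlMr ?mulr_gt0 //.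
    lra.
  have h4 : #|G|%:R * (1 - D%:R / (4 * #|G|%:R)) ^+ k <= expR (ln #|G|%:R - alpha * k%:R / 4) :> R.
    by rewrite expRD lnK ?posrE // ler_wpM2l // ltW.
  have := le_trans h1 (le_trans h2 (le_trans Ssum h4)); rewrite ler_expR.
  lra.
have S0 : S != set0 by rewrite -card_gt0 Sk.
have [|K [SK Kc K0]] := connect_dominating con S0.
  by move=> v _; apply: leq_trans (cov v); apply: ltnW.
exists K, t; split=> // [v _|].
  by apply: leq_trans (cov v) _; apply/subset_leq_card/nb_sub.
have K3 : #|K|%:R <= 3 * s.
  apply: (@le_trans _ _ (3 * k%:R)); last by lra.
  by rewrite -natrM ler_nat -Sk.
apply: lerD; first by rewrite ler_wpM2r.
have tE : t.-1%:R = t%:R - 1 :> R.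
  by rewrite -[in RHS](ltn_predK t2) -natr1 addrK.
(* From t > alpha s / 16 - 1; the assumption 64 <= alpha s absorbs the two units lost to rounding
   and to the predecessor. *)
have tp : alpha * s / 32 <= t.-1%:R by rewrite tE; lra.
have as0 : 0 < alpha * s / 32 by lra.
apply: (@le_trans _ _ (#|G|%:R / (alpha * s / 32))).
  by rewrite ler_pM2l // lef_pV2 ?posrE // (lt_le_trans as0).
have sN0 : s != 0 by rewrite gt_eqF //; lra.
rewrite nE le_eqVlt; apply/orP; left; apply/eqP; field.
by rewrite sN0 gt_eqF.
Qed.

(** * Asymptotic estimates *)

(* lam stands for log n; the constant 100 ^+ 4 is large enough for all the estimates
   of this section. *)
Section Numerics.
Context {R : realType} (alpha lam : R).
Hypotheses (a01 : 0 < alpha <= 1) (la : 100 ^+ 4 <= lam * alpha ^+ 3).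
Let s := expR (lam / 2).

Let a0 : 0 < alpha. Proof. by case/andP: a01. Qed.
Let a1 : alpha <= 1. Proof. by case/andP: a01. Qed.
Let hund : 0 < 100 ^+ 4 :> R. Proof. by apply: exprn_gt0. Qed.
Let lam0 : 0 < lam.
Proof. by rewrite -(pmulr_lgt0 _ (exprn_gt0 3 a0)); apply: lt_le_trans hund la. Qed.

Lemma lam_alpha_ge k : (k <= 3)%N -> 100 ^+ 4 <= lam * alpha ^+ k.
Proof.
move=> k3; apply: le_trans la _; rewrite ler_pM2l //.
by rewrite ler_wiXn2l // ltW.
Qed.

(** The fourth Taylor term, 384 = 2^4 * 4!; division by lam^2 in [concentration_margin] must still
    leave a square of lam. *)
Lemma sqrt_exp_ge : lam ^+ 4 / 384 <= s.
Proof.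
have h0 : 0 <= lam / 2 by rewrite divr_ge0 // ltW.
have := expR_ge1Dxn 3 h0.
have -> : (4`!)%:R = 24 :> R by [].
have -> : (lam / 2) ^+ 4 / 24 = lam ^+ 4 / 384 by field.
rewrite /s; lra.
Qed.

Lemma alpha_sqrt_ge : 16 * lam <= alpha * s /\ 64 <= alpha * s.
Proof.
have l1 := lam_alpha_ge (isT : 1 <= 3)%N; have l0 := lam_alpha_ge (isT : 0 <= 3)%N.
rewrite expr1 in l1; rewrite expr0 mulr1 in l0.
have h : lam ^+ 3 / 384 * 100 ^+ 4 <= alpha * s.
  apply: (@le_trans _ _ (alpha * (lam ^+ 4 / 384))); last by apply: ler_wpM2l; [exact: ltW|exact: sqrt_exp_ge].
  have -> : alpha * (lam ^+ 4 / 384) = lam ^+ 3 / 384 * (lam * alpha) by field.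
  by rewrite ler_wpM2l // divr_ge0 // exprn_ge0 // ltW.
have l3 : lam <= lam ^+ 3.
  rewrite -[X in X <= _]expr1 ler_eXn2l //; lra.
lra.
Qed.

Lemma concentration_margin :
  3 * s * lam + 32 * s / alpha + lam / 3 + 16 <= alpha ^+ 2 * s ^+ 2 / (3200 * lam ^+ 2).
Proof.
have l2 := lam_alpha_ge (isT : 2 <= 3)%N; have l1 := lam_alpha_ge (isT : 1 <= 3)%N.
have l0 := lam_alpha_ge (isT : 0 <= 3)%N; rewrite expr1 in l1; rewrite expr0 mulr1 in l0.
have s4 := sqrt_exp_ge.
have s0 : 0 < s by apply: expR_gt0.
have lamN : lam != 0 by rewrite gt_eqF.
(* 37 = 3 + 32 + 1 + 1, one part for each term on the left, all bounded by multiples of s lam. It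
   requires lam alpha^2 >= 37 * 384 * 3200, which is below 100^4. *)
have q : 37 * lam <= alpha ^+ 2 * s / (3200 * lam ^+ 2).
  apply: (@le_trans _ _ (alpha ^+ 2 * (lam ^+ 4 / 384) / (3200 * lam ^+ 2))); last first.
    rewrite ler_pM2r ?invr_gt0 ?mulr_gt0 ?exprn_gt0 //.
    by rewrite ler_pM2l // exprn_gt0.
  have -> : alpha ^+ 2 * (lam ^+ 4 / 384) / (3200 * lam ^+ 2) = lam * ((lam * alpha ^+ 2) / (384 * 3200)).
    by field.
  rewrite mulrC ler_pM2l // ler_pdivlMr ?mulr_gt0 //; lra.
have -> : alpha ^+ 2 * s ^+ 2 / (3200 * lam ^+ 2) = s * (alpha ^+ 2 * s / (3200 * lam ^+ 2)).
  by field.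
apply: le_trans (_ : s * (37 * lam) <= _); last by rewrite ler_pM2l.
have ia : alpha^-1 <= lam by rewrite -div1r ler_pdivrMr //; lra.
have sa : s / alpha <= s * lam by rewrite ler_pM2l.
have sl : lam <= s.
  have l4 : lam * lam ^+ 3 <= 384 * s by rewrite -exprS; lra.
  have l3 : 384 <= lam ^+ 3.
    have : lam <= lam ^+ 3 by rewrite -[X in X <= _]expr1 ler_eXn2l //; lra.
    lra.
  have : lam * 384 <= lam * lam ^+ 3 by rewrite ler_pM2l.
  lra.
have sll : s <= s * lam by rewrite ler_peMr ?(ltW s0) //; lra.
lra.
Qed.

Lemma main_margin : (2 / alpha + lam / 3) * expR (- (lam / 6)) <= 8^-1.
Proof.
have l1 := lam_alpha_ge (isT : 1 <= 3)%N; rewrite expr1 in l1.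
have l0 := lam_alpha_ge (isT : 0 <= 3)%N; rewrite expr0 mulr1 in l0.
rewrite expRN ler_pdivrMr ?expR_gt0 //.
have h0 : 0 <= lam / 6 by rewrite divr_ge0 // ltW.
have := expR_ge1Dxn 1 h0.
have -> : (2`!)%:R = 2 :> R by [].
have -> : (lam / 6) ^+ 2 / 2 = lam * lam / 72 by field.
have ia : alpha^-1 <= lam / 100 ^+ 4.
  by rewrite ler_pdivlMr // mulrC ler_pdivrMr.
have ll : lam * 1000 <= lam * lam by rewrite ler_pM2l //; lra.
have : lam / 100 ^+ 4 <= lam / 100.
  by apply: ler_wpM2l; [exact: ltW|rewrite lef_pV2 ?posrE //; lra].
lra.
Qed.

(** For large sets A: it keeps (1 + 2 y)^n below exp (alpha n lam / 16), half the exponent gained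
    from b^m. *)
Lemma exp_margin : 1 + lam <= expR (alpha * lam / 16).
Proof.
have l2 := lam_alpha_ge (isT : 2 <= 3)%N.
have h0 : 0 <= alpha * lam / 16 by rewrite divr_ge0 // mulr_ge0 // ltW.
have := expR_ge1Dxn 1 h0.
have -> : (2`!)%:R = 2 :> R by [].
have -> : (alpha * lam / 16) ^+ 2 / 2 = lam * (lam * alpha ^+ 2) / 512 by field.
have : lam * 512 <= lam * (lam * alpha ^+ 2) by rewrite ler_pM2l //; lra.
lra.
Qed.
End Numerics.

Lemma error_margin (R : realType) (alpha lam y b D : R) (N m : nat) :
  0 < alpha <= 1 -> 100 ^+ 4 <= lam * alpha ^+ 3 -> N%:R = expR lam ->
  alpha * N%:R <= D -> 0 <= y -> y / D <= lam / (6 * N%:R) -> y <= lam / 6 ->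
  D <= 2 * b -> alpha * N%:R / 4 <= m%:R ->
  (2 / D + y / b) * (1 + 2 * (y / b)) ^+ N + (2 / D + y) * (b ^- m * (1 + 2 * y) ^+ N)
  <= 4^-1 * expR (- (lam / 6)).
Proof.
move=> a01 la nE aD y0 yDn ylam bD mR; have /andP[a0 a1] := a01.
set n : R := N%:R in nE aD yDn mR *.
have n0 : 0 < n by rewrite nE expR_gt0.
set s := expR (lam / 2); have s0 : 0 < s by apply: expR_gt0.
have n_s : n = s * s by rewrite nE -expRD; congr expR; field.
have [as16 as64] := alpha_sqrt_ge a01 la; rewrite -/s in as16 as64.
have l100 := lam_alpha_ge a01 la (isT : 0 <= 3)%N; rewrite expr0 mulr1 in l100.
have lam100 : 100 <= lam.
  by apply: le_trans l100; rewrite -[X in X <= _]expr1 ler_eXn2l // ltr1n.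
have mm := main_margin a01 la; have em := exp_margin a01 la; clear la l100.
have lam0 : 0 < lam by lra.
have as_s : alpha * s <= s by rewrite ler_piMl // ltW.
have an : 64 * s <= alpha * n by rewrite n_s mulrA ler_pM2r.
have DR : 0 < D by lra.
have b0 : 0 < b by lra.
set M := 2 / alpha + lam / 3.
have M0 : 0 < M by rewrite addr_gt0 ?divr_gt0.
have yb : y / b <= lam / (3 * n).
  have -> : lam / (3 * n) = 2 * (lam / (6 * n)) by field; rewrite gt_eqF.
  apply: (@le_trans _ _ (2 * (y / D))); last by rewrite ler_pM2l.
  rewrite mulrCA ler_wpM2l //.
  by rewrite -div1r ler_pdivrMr // mulrAC ler_pdivlMr // mul1r.
have yb0 : 0 <= y / b by rewrite divr_ge0 // ltW.
have f1 : 2 / D + y / b <= M / n.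
  have -> : M / n = 2 / (alpha * n) + lam / (3 * n).
    by rewrite /M; field; rewrite !gt_eqF.
  by rewrite lerD // ler_pM2l // lef_pV2 ?posrE // mulr_gt0.
have f2 : (1 + 2 * (y / b)) ^+ N <= expR (lam * (2 / 3)).
  have -> : lam * (2 / 3) = N%:R * (2 * (lam / (3 * n))).
    by rewrite -/n; field; rewrite gt_eqF.
  rewrite expRM_natl lerXn2r ?nnegrE ?expR_ge0 //; first by clear -yb0; lra.
  by apply: le_trans (expR_ge1Dx _); clear -yb; lra.
rewrite -/M in mm.
have term1 : (2 / D + y / b) * (1 + 2 * (y / b)) ^+ N <= 8^-1 * expR (- (lam / 6)).
  apply: (@le_trans _ _ (M / n * expR (lam * (2 / 3)))).
    apply: ler_pM => //; first by rewrite addr_ge0 // divr_ge0 // ltW.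
    by rewrite exprn_ge0 //; clear -yb0; lra.
  rewrite nE -expRN.
  (* Of the remaining exp (- lam / 3), one half is the size of the main term and the other half
     absorbs M by [main_margin]. *)
  have -> : M * expR (- lam) * expR (lam * (2 / 3)) = M * expR (- (lam / 6)) * expR (- (lam / 6)).
    by rewrite -!mulrA -!expRD; congr (_ * expR _); field.
  by rewrite ler_wpM2r ?expR_ge0.
have sb : s <= b by lra.
have f3 : b ^- m * (1 + 2 * y) ^+ N <= expR (- lam).
  have g1 : (1 + 2 * y) ^+ N <= expR (n * (alpha * lam / 16)).
    rewrite expRM_natl lerXn2r ?nnegrE ?expR_ge0 //; first by clear -y0; lra.
    by apply: le_trans em; clear -ylam lam0; lra.
  have g2 : expR (alpha * n / 4 * (lam / 2)) <= b ^+ m.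
    apply: (@le_trans _ _ (s ^+ m)).
      by rewrite /s -expRM_natl ler_expR ler_wpM2r // divr_ge0 // ltW.
    by rewrite lerXn2r ?nnegrE // ltW.
  rewrite mulrC ler_pdivrMr ?exprn_gt0 // (le_trans g1) //.
  apply: (@le_trans _ _ (expR (- lam) * expR (alpha * n / 4 * (lam / 2)))); last first.
    by rewrite ler_wpM2l ?expR_ge0.
  rewrite -expRD ler_expR.
  have : 16 * lam <= alpha * n * lam by rewrite ler_pM2r //; lra.
  by clear; lra.
have term2 : (2 / D + y) * (b ^- m * (1 + 2 * y) ^+ N) <= 8^-1 * expR (- (lam / 6)).
  apply: (@le_trans _ _ (M * expR (- (lam / 6)) * expR (- (lam / 6)))).
    rewrite -mulrA -expRD; apply: ler_pM.
    - by rewrite addr_ge0 // divr_ge0 // ltW.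
    - by rewrite mulr_ge0 ?invr_ge0 ?exprn_ge0 // ?(ltW b0) //; clear -y0; lra.
    - have : 2 / D <= 2 / alpha by rewrite ler_pM2l // lef_pV2 ?posrE //; lra.
      by rewrite /M; clear -ylam lam0; lra.
    - by apply: le_trans f3 _; rewrite ler_expR; lra.
  by rewrite ler_wpM2r ?expR_ge0.
have := lerD term1 term2; clear; lra.
Qed.

(** * Nonvanishing *)

(* The loss exp (3 s lam + 32 s / alpha) of density, with s = sqrt n, is absorbed by
   the concentration bound exp (- alpha^2 n / (3200 lam^2)). *)
Lemma few_bad_trees (R : realType) (G : sgraph) (D : nat) (alpha lam y : R) :
  connected G -> (forall v : G, (D <= degree v)%N) -> (0 < D <= #|G|)%N -> 0 < alpha <= 1 ->
  100 ^+ 4 <= lam * alpha ^+ 3 -> #|G|%:R = expR lam -> alpha * #|G|%:R <= D%:R ->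
  y * (#|G|%:R / D%:R) <= lam / 6 ->
  exists r mu, [/\ 0 <= mu <= #|G|%:R / D%:R, (0 < #|treemaps r [set: G]|)%N &
    #|[set f in treemaps r [set: G] | (10 * lam)^-1 < `|leafweight R f - mu|]|%:R
      * expR (2 * (y * (#|G|%:R / D%:R))) <= 8^-1 * #|treemaps r [set: G]|%:R].
Proof.
move=> con deg /andP[D0 Dn] a01 la nE aD yl.
have /andP[a0 a1] := a01.
set n : R := #|G|%:R in nE aD yl *; set s := expR (lam / 2).
have n0 : 0 < n by rewrite nE expR_gt0.
have DR : 0 < D%:R :> R by rewrite ltr0n.
have DnR : D%:R <= n by rewrite ler_nat.
have ln_n : ln n = lam by rewrite nE expRK.
have n_s : n = s ^+ 2 by rewrite nE expr2 -expRD; congr expR; field.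
have [as16 as64] := alpha_sqrt_ge a01 la; rewrite -/s in as16 as64.
have cm := concentration_margin a01 la; rewrite -/s -n_s in cm.
have l100 := lam_alpha_ge a01 la (isT : 0 <= 3)%N; rewrite expr0 mulr1 in l100.
have lam1 : 1 <= lam by apply: le_trans l100; rewrite exprn_ege1 // ler1n.
have lam0 : 0 < lam by apply: lt_le_trans lam1.
have lnas : 16 * ln n <= alpha * s by rewrite ln_n.
have [K [t [K0 t1 tK loss]]] := core_exists con deg Dn a01 n_s aD as64 lnas.
rewrite -/n ln_n in loss.
have [r rK] : exists r, r \in K.
  by apply/set0Pn; apply: contraTneq K0 => ->; rewrite tau0.
have dens := density R rK K0 t1 tK; rewrite -/n ln_n in dens.
have c0 : 0 < 2 / D%:R :> R by rewrite divr_gt0.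
have [mu mub conc] := product_concentration (fun v => card_choices_gt0 r v D0 deg) c0
  (leafweight_osc R D0 deg) (fun f => leafweight_bounds R f D0 deg).
exists r, mu; split => //.
  rewrite lt0n; apply/eqP => T0; move: dens; rewrite T0 mulr0 leNgt => /negP; apply.
  rewrite ltr0n card_family foldrE big_map prodn_gt0 // => v; exact: card_choices_gt0 D0 deg.
set del := (10 * lam)^-1; set T := treemaps r [set: G] in dens *.
have del0 : 0 < del by rewrite invr_gt0 mulr_gt0.
have del1 : del <= 1 by rewrite invf_le1 ?mulr_gt0 //; clear -lam1; lra.
(* The minimiser of the exponent 2 (t c)^2 n - t del for c = 2 / D. The minimum is - del^2 D^2 / (32
   n), and del = 1 / (10 lam) makes the 3200 of E out of 32 * 10^2. *)
pose tt := del * D%:R ^+ 2 / (16 * n).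
have tt0 : 0 <= tt by rewrite divr_ge0 ?mulr_ge0 ?exprn_ge0 // ltW.
have ttc : tt * (2 / D%:R) = del * (D%:R / n) / 8.
  by rewrite /tt; field; rewrite !gt_eqF.
have Dn1 : D%:R / n <= 1 by rewrite ler_pdivrMr // mul1r.
have ttc1 : tt * (2 / D%:R) <= 1.
  rewrite ttc; have : del * (D%:R / n) <= 1 * 1.
    by rewrite ler_pM // ?ltW // divr_gt0.
  by clear; lra.
have := conc tt del tt0 ttc1; rewrite -/n ttc.
set E := alpha ^+ 2 * n / (3200 * lam ^+ 2) in cm.
have -> : 2 * (del * (D%:R / n) / 8) ^+ 2 * n - tt * del = - (del ^+ 2 * D%:R ^+ 2 / (32 * n)).
  by rewrite /tt; field; rewrite gt_eqF.
have Ele : E <= del ^+ 2 * D%:R ^+ 2 / (32 * n).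
  have -> : E = del ^+ 2 * (alpha * n) ^+ 2 / (32 * n).
    by rewrite /E /del; field; rewrite !gt_eqF.
  rewrite ler_pM2r ?invr_gt0 ?mulr_gt0 // ler_pM2l ?exprn_gt0 //.
  by rewrite lerXn2r ?nnegrE ?mulr_ge0 // ltW.
move=> bad.
(* The 16 set aside in [concentration_margin] pays for the two tails: 2/17 <= 1/8. *)
have e16 : expR (-16) <= 17^-1 :> R.
  by rewrite expRN lef_pV2 ?posrE ?expR_gt0 //; have := expR_ge1Dx (16 : R); clear; lra.
set Bd := [set f in T | _].
have BB : #|Bd|%:R <= 2 * expR (- E) * #|family (choices r)|%:R.
  apply: le_trans (le_trans bad _); last first.
    by rewrite ler_wpM2r // ler_wpM2l // ler_expR lerN2.
  rewrite ler_nat; apply: subset_leq_card; apply/subsetP => f.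
  move=> /setIdP[fT fd]; rewrite in_set fd andbT; exact: treemaps_choices fT.
have B2 : #|Bd|%:R <= 2 * expR (- E) * (expR (3 * s * lam + 32 * s / alpha) * #|T|%:R).
  apply: le_trans BB _; rewrite ler_wpM2l ?mulr_ge0 ?expR_ge0 //.
  by apply: le_trans dens _; rewrite ler_wpM2r // ler_expR.
have e2 : expR (2 * (y * (n / D%:R))) <= expR (lam / 3) by rewrite ler_expR; clear -yl; lra.
apply: (@le_trans _ _ (2 * expR (- E) * (expR (3 * s * lam + 32 * s / alpha) * #|T|%:R) * expR (lam / 3))).
  by apply: ler_pM; rewrite ?expR_ge0.
have -> : 2 * expR (- E) * (expR (3 * s * lam + 32 * s / alpha) * #|T|%:R) * expR (lam / 3) =
    2 * expR (- E + (3 * s * lam + 32 * s / alpha) + lam / 3) * #|T|%:R.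
  by rewrite !expRD; ring.
rewrite ler_wpM2r //.
have : expR (- E + (3 * s * lam + 32 * s / alpha) + lam / 3) <= expR (-16).
  by rewrite ler_expR; clear -cm; lra.
by clear -e16; lra.
Qed.

(** In units of exp (- lam / 6) tau(V), the leaf sum has modulus at least 3/8, but lies within 1/4
    of the full sum. *)
Lemma sum_tau_neq0 (R : realType) (G : sgraph) (alpha lam : R) (z : R[i]) :
  connected G -> 0 < alpha -> 100 ^+ 4 <= lam * alpha ^+ 3 -> #|G|%:R = expR lam ->
  (forall v : G, alpha * #|G|%:R <= (degree v)%:R) -> normc z <= alpha * lam / 6 ->
  \sum_(A : {set G}) (tau (~: A))%:R * z ^+ #|A| != 0.
Proof.
move=> con a0 la nE adeg zle; set n : R := #|G|%:R in nE adeg *.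
have n0 : 0 < n by rewrite nE expR_gt0.
have [g _] : exists g : G, true by move: n0; rewrite ltr0n => /card_gt0P[g _]; exists g.
have [D [deg aD Dn]] : exists D, [/\ forall v : G, (D <= degree v)%N, alpha * n <= D%:R & (D <= #|G|)%N].
  case: (@arg_minnP G g xpredT (@degree G) isT) => v _ vmin.
  by exists (degree v); split=> // [w|]; [apply: vmin|rewrite /degree max_card].
have DR : 0 < D%:R :> R by apply: lt_le_trans aD; rewrite mulr_gt0.
have D0 : (0 < D)%N by rewrite -(ltr0n R).
have a1 : alpha <= 1.
  by rewrite -(ler_pM2r n0) mul1r (le_trans aD) // ler_nat.
have a01 : 0 < alpha <= 1 by rewrite a0.
have DD : (0 < D <= #|G|)%N by rewrite D0.
set y := normc z in zle *; have y0 : 0 <= y by apply: normc_ge0.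
set s := expR (lam / 2); have s0 : 0 < s by apply: expR_gt0.
have n_s : n = s * s by rewrite nE -expRD; congr expR; field.
have [as16 as64] := alpha_sqrt_ge a01 la; rewrite -/s in as16 as64.
have l100 := lam_alpha_ge a01 la (isT : 0 <= 3)%N; rewrite expr0 mulr1 in l100.
have lam100 : 100 <= lam.
  by apply: le_trans l100; rewrite -[X in X <= _]expr1 ler_eXn2l // ltr1n.
have lam0 : 0 < lam by lra.
have as_s : alpha * s <= s by rewrite ler_piMl // ltW.
have an : 64 * s <= alpha * n by rewrite n_s mulrA ler_pM2r.
have yD : y * (n / D%:R) <= lam / 6.
  rewrite mulrA ler_pdivrMr //; apply: (@le_trans _ _ (alpha * lam / 6 * n)).
    by rewrite ler_wpM2r // ltW.
  have : lam * (alpha * n) <= lam * D%:R by rewrite ler_pM2l.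
  lra.
have yDn : y / D%:R <= lam / (6 * n).
  have -> : y / D%:R = y * (n / D%:R) / n by field; rewrite !gt_eqF.
  have -> : lam / (6 * n) = lam / 6 / n by rewrite invfM mulrA.
  by rewrite ler_pM2r ?invr_gt0.
have alam : alpha * lam <= lam by rewrite ler_piMl // ltW.
have ylam : y <= lam / 6 by lra.
have D1 : (1 < D)%N by rewrite -(ltr_nat R); lra.
(* The choice m = D/2, rounded down, keeps both b = D - m and m linear in n. *)
have [mD bD4 mD4] : [/\ D./2 < D, D <= 2 * (D - D./2) & D <= 4 * D./2]%N.
  by clear -D1; split; lia.
have [r [mu [mub T0 bad]]] := few_bad_trees con deg DD a01 la nE aD yD.
set T := treemaps r [set: G] in T0 bad.
have ydel : y * (10 * lam)^-1 <= 60^-1.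
  by rewrite ler_pdivrMr ?mulr_gt0 //; clear -zle alam; lra.
have small : 9 * n * (y / D%:R) ^+ 2 + 5 * (y * (10 * lam)^-1) <= 4^-1.
  have h1 : 9 * n * (y / D%:R) ^+ 2 <= 9 * n * (lam / (6 * n)) ^+ 2.
    apply: ler_wpM2l; first by rewrite mulr_ge0 // ltW.
    have p1 : 0 <= y / D%:R by rewrite divr_ge0.
    have p2 : 0 <= lam / (6 * n) by rewrite divr_ge0 ?mulr_ge0 // ltW.
    by rewrite lerXn2r ?nnegrE.
  have h2 : 9 * n * (lam / (6 * n)) ^+ 2 <= 1000^-1.
    have -> : 9 * n * (lam / (6 * n)) ^+ 2 = lam * lam / (4 * n) by field; rewrite gt_eqF.
    rewrite ler_pdivrMr ?mulr_gt0 // n_s.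
    have : 16 * lam * (16 * lam) <= s * s.
      by apply: ler_pM; rewrite ?mulr_ge0 ?(ltW lam0) // (le_trans as16).
    by clear -n0 n_s; lra.
  by clear -h1 h2 ydel; lra.
have yleD : y <= D%:R by clear -ylam as16 as_s an aD s0; lra.
have ydel1 : y * (10 * lam)^-1 <= 1 by clear -ydel; lra.
have lower := sum_leafpoly_lb D0 deg yleD ydel1 mub small bad.
apply/eqP => S0.
have := sum_leafpoly_error r con deg mD (erefl (normc z)) erefl.
rewrite S0 sub0r normcN -/y -/T (tauE (in_setT r)) -/T.
set b : R := (D - D./2)%:R; set Q := normc _.
move=> upper.
have bD : D%:R <= 2 * b by rewrite /b -natrM ler_nat.
have mR : alpha * n / 4 <= (D./2)%:R.
  have : D%:R <= 4 * (D./2)%:R :> R by rewrite -natrM ler_nat.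
  by clear -aD; lra.
have TR : 0 < #|T|%:R :> R by rewrite ltr0n.
have marg := error_margin a01 la nE aD y0 yDn ylam bD mR.
have E0 : 0 < expR (- (lam / 6)) by apply: expR_gt0.
have Q1 : Q <= #|T|%:R * (4^-1 * expR (- (lam / 6))).
  by apply: le_trans upper _; rewrite ler_pM2l.
have Q2 : expR (- (lam / 6)) * (3 / 8 * #|T|%:R) <= Q.
  apply: le_trans lower; apply: ler_wpM2r; first by rewrite mulr_ge0 // divr_ge0.
  by rewrite ler_expR lerN2.
have TE : 0 < #|T|%:R * expR (- (lam / 6)) by apply: mulr_gt0.
by clear -TE Q1 Q2; lra.
Qed.

Theorem theorem3 (R : realType) (alpha C : R)
    (halpha : 0 < alpha) (hC : 6%:R < C) :
  exists n0 : nat, forall n : nat, (n0 <= n)%N ->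
  forall G : sgraph, #|G| = n -> connected G ->
  (forall v : G, alpha * n%:R <= (degree v)%:R) ->
  forall x : R[i], root (subtree_poly R[i] G) x ->
    `|x| <= (C / (alpha * ln n%:R))%:C.
Proof.
(* Chosen so that log n >= 100^4 / alpha^3, the standing assumption of all the numerical
   estimates. *)
exists (Num.truncn (expR (100 ^+ 4 / alpha ^+ 3))).+1 => n nlarge G Gn con adeg x xroot.
have large : expR (100 ^+ 4 / alpha ^+ 3) < n%:R by rewrite -truncn_lt_nat ?expR_ge0.
have n0 : 0 < n%:R :> R by apply: le_lt_trans large; apply: expR_ge0.
set lam := ln n%:R.
have nE : n%:R = expR lam by rewrite lnK ?posrE.
have la : 100 ^+ 4 <= lam * alpha ^+ 3.
  by rewrite -ler_pdivrMr ?exprn_gt0 // ltW // -ltr_expR -nE.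
have lam0 : 0 < lam.
  by rewrite -(pmulr_lgt0 _ (exprn_gt0 3 halpha)); apply: lt_le_trans la; apply: exprn_gt0.
have C0 : 0 < C by apply: lt_trans hC.
have B0 : 0 < C / (alpha * lam) by rewrite divr_gt0 ?mulr_gt0.
rewrite norm_normc lecR leNgt; apply/negP => xlarge.
have x0 : x != 0 by apply: contraTneq xlarge => ->; rewrite normc0 -leNgt ltW.
have nx : normc x^-1 <= alpha * lam / 6.
  rewrite normcV; apply: (@le_trans _ _ (C / (alpha * lam))^-1).
    have nx0 := lt_trans B0 xlarge; by rewrite lef_pV2 ?posrE //; exact: ltW.
  by rewrite invf_div ler_pM2l ?mulr_gt0 // lef_pV2 ?posrE //; exact: ltW.
have := sum_tau_neq0 con halpha la _ _ nx; rewrite Gn.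
by move=> /(_ nE adeg); rewrite subtree_poly_root // eqxx.
Qed.
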